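(* Let $k,t$ be positive integers and let $n\geq 111t^3k^3$. If $G$ is a connected graph with $n$ vertices and at most $n\left(1+\frac{1}{127t^2k^2+79t^2k}\right)$ edges, then $r(G,tB_k)=2n+t-2$.
   Context: For graphs $G,H$, the Ramsey number $r(G,H)$ is the smallest positive integer $N$ such that every red-blue coloring of the edges of the complete graph $K_N$ contains a red subgraph isomorphic to $G$ or a blue subgraph isomorphic to $H$. The book $B_k$ is the graph $K_2+\overline{K}_k$ on $k+2$ vertices (an edge together with $k$ further vertices each adjacent to both endpoints of the edge), and $tB_k$ denotes the disjoint union of $t$ vertex-disjoint copies of $B_k$. All graphs are finite and simple. *)

(* Defs.v *)
From HB Require Import structures.
From mathcomp Require Import all_boot all_order all_algebra.

Set Implicit Arguments.
Unset Strict Implicit.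
Unset Printing Implicit Defensive.

Record sgraph := SGraph {
  vertex :> finType;
  adj : rel vertex;
  adj_sym : symmetric adj;
  adj_irrefl : irreflexive adj }.

Definition edges (G : sgraph) : {set {set G}} :=
  [set [set p.1; p.2] | p in [pred p : G * G | adj p.1 p.2]].

Definition connected_graph (G : sgraph) : Prop :=
  0 < #|G| /\ forall x y : G, connect (@adj G) x y.

Section Complete.
Variable n : nat.
Definition complete_adj : rel 'I_n := fun x y => x != y.
Fact complete_sym : symmetric complete_adj.
Proof. by move=> x y; rewrite /complete_adj eq_sym. Qed.
Fact complete_irrefl : irreflexive complete_adj.
Proof. by move=> x; rewrite /complete_adj eqxx. Qed.
Definition complete : sgraph := SGraph complete_sym complete_irrefl.
End Complete.

Section Complement.
Variable G : sgraph.
Definition complement_adj : rel G := fun x y => (x != y) && ~~ adj x y.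
Fact complement_sym : symmetric complement_adj.
Proof. by move=> x y; rewrite /complement_adj eq_sym adj_sym. Qed.
Fact complement_irrefl : irreflexive complement_adj.
Proof. by move=> x; rewrite /complement_adj eqxx. Qed.
Definition complement : sgraph := SGraph complement_sym complement_irrefl.
End Complement.

Section Join.
Variables G H : sgraph.
Definition join_adj : rel (G + H)%type := fun u v =>
  match u, v with
  | inl x, inl y => adj x y
  | inr x, inr y => adj x y
  | _, _ => true
  end.
Fact join_sym : symmetric join_adj.
Proof. by case=> x [] y //=; exact: adj_sym. Qed.
Fact join_irrefl : irreflexive join_adj.
Proof. by case=> x /=; exact: adj_irrefl. Qed.
Definition join : sgraph := SGraph join_sym join_irrefl.
End Join.

Section Copies.
Variables (t : nat) (G : sgraph).
Definition copies_adj : rel ('I_t * G)%type := fun u v =>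
  (u.1 == v.1) && adj u.2 v.2.
Fact copies_sym : symmetric copies_adj.
Proof. by move=> u v; rewrite /copies_adj eq_sym adj_sym. Qed.
Fact copies_irrefl : irreflexive copies_adj.
Proof. by move=> u; rewrite /copies_adj adj_irrefl andbF. Qed.
Definition copies : sgraph := SGraph copies_sym copies_irrefl.
End Copies.

Definition book (k : nat) : sgraph := join (complete 2) (complement (complete k)).

(* [F] has a (not necessarily induced) subgraph isomorphic to [G]. *)
Definition has_copy (G F : sgraph) : Prop :=
  exists2 f : G -> F, injective f & forall x y : G, adj x y -> adj (f x) (f y).

(* A red-blue coloring assigns [true] (red) or [false] (blue) to each edge
   [[set x; y]] of [complete N]; its values on other sets are never used. *)
Definition coloring (N : nat) := {set 'I_N} -> bool.

Section ColorClass.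
Variables (N : nat) (c : coloring N) (b : bool).
Definition color_adj : rel 'I_N := fun x y =>
  @adj (complete N) x y && (c [set x; y] == b).
Fact color_sym : symmetric color_adj.
Proof. by move=> x y; rewrite /color_adj adj_sym setUC. Qed.
Fact color_irrefl : irreflexive color_adj.
Proof. by move=> x; rewrite /color_adj adj_irrefl. Qed.
Definition color_class : sgraph := SGraph color_sym color_irrefl.
End ColorClass.

Definition arrows (N : nat) (G H : sgraph) : Prop :=
  forall c : coloring N,
    has_copy G (color_class c true) \/ has_copy H (color_class c false).

(* r(G, H) = N. *)
Definition is_ramsey_number (G H : sgraph) (N : nat) : Prop :=
  [/\ 0 < N, arrows N G H & forall M, 0 < M -> arrows M G H -> N <= M].

(* Main.v *)
Require Import Defs.
From mathcomp Require Import all_boot all_order all_algebra zify.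
Import Order.TTheory GRing.Theory Num.Theory.

(* Lower bound: two red cliques on [n - 1] vertices and one on [t - 1], blue in
   between; every blue triangle meets the small part.

   Upper bound, by induction on the number of vertices of the guest, with the
   host and the excess of edges over vertices fixed.  Outside a maximal family
   of disjoint blue books, blue neighbourhoods are nearly red cliques, and a
   sparse graph embeds greedily into a near clique that is slightly larger
   than it.  If the guest is much smaller than half of the host, it embeds
   greedily.  Otherwise it has either a long path with interior degrees 2 or
   many leaves.
   - Long path: contract an edge of it and embed.  If the red image of the path
     cannot absorb an unused vertex, then every unused vertex is blue to almost
     all of the path, so the unused vertices have no blue matching of size [t]
     and form a red clique up to fewer than [t] vertices.
   - Many leaves: embed the guest without its leaves and attach these by Hall's
     theorem.  A violator yields a large set of vertices that is blue to all the
     parents involved, hence an exact near clique, unless some vertex carries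
     many leaves.  In that case either a vertex of a near clique has red degree
     large enough to be its image, or two near cliques with almost complete
     blue connection cover nearly everything, and counting the remaining
     vertices produces [t] disjoint blue books. *)

Set Implicit Arguments.
Unset Strict Implicit.
Unset Printing Implicit Defensive.

(** * Finite sets *)

Lemma exists_notin (T : finType) (A B : {set T}) :
  #|B| < #|A| -> exists2 x, x \in A & x \notin B.
Proof.
move=> lt; apply/subsetPn; apply: contraTN lt => /subset_leq_card.
by rewrite -leqNgt.
Qed.

Lemma card_bigcup_le (I T : finType) (A : {set I}) (F : I -> {set T}) d :
  {in A, forall i, #|F i| <= d} -> #|\bigcup_(i in A) F i| <= #|A| * d.
Proof.
move=> le; rewrite -sum_nat_const; apply: leq_trans (leq_sum _ le).
elim/big_rec2: _ => [|y m X yn leX]; first by rewrite cards0.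
by apply: leq_trans (leq_card_setU _ _) _; rewrite leq_add2l.
Qed.

(** * Greedy embeddings into near cliques *)

Section Guest.
Variable V : finType.
Implicit Types (e : rel V) (S X : {set V}).

Definition nbh e S x := [set y in S | e x y].

Definition degree_sum e X := \sum_(x in X) #|nbh e X x|.

Definition sparse e l S :=
  forall X, X \subset S -> degree_sum e X <= 2 * (#|X| + l).

(* Connectedness in the form that is stable under deletion of leaves and
   contraction. *)
Definition conn e S := forall X, X \subset S -> X != set0 ->
  (forall x y, x \in X -> y \in S -> e x y -> y \in X) -> X = S.

Lemma nbhE e S x y : (y \in nbh e S x) = (y \in S) && e x y.
Proof. by rewrite inE. Qed.

Lemma nbhS e S X x : X \subset S -> #|nbh e X x| <= #|nbh e S x|.
Proof.
move=> sXS; apply/subset_leq_card/subsetP => y; rewrite !nbhE => /andP[yX ->].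
by rewrite (subsetP sXS).
Qed.

Lemma nbh_lt e S x : irreflexive e -> x \in S -> #|nbh e S x| <= #|S|.-1.
Proof.
move=> e_irr xS; have -> : #|S|.-1 = #|S :\ x| by rewrite (cardsD1 x S) xS.
apply/subset_leq_card/subsetP => y; rewrite nbhE !inE => /andP[-> exy].
by rewrite andbT; apply: contraTneq exy => ->; rewrite e_irr.
Qed.

Lemma sparseS e l S X : X \subset S -> sparse e l S -> sparse e l X.
Proof. by move=> sXS spS Y sYX; apply: spS; apply: subset_trans sXS. Qed.

Lemma exists_degree_le2 e l S p : p \in S -> sparse e l S -> 2 * l + 3 < #|S| ->
  exists2 y, y \in S :\ p & #|nbh e S y| <= 2.
Proof.
move=> pS spS ltS.
case: (boolP [exists y in S :\ p, #|nbh e S y| <= 2]).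
  by case/existsP => y /andP[]; exists y.
rewrite negb_exists => /forallP noy.
have := spS S (subxx _); rewrite /degree_sum (big_setD1 p) //=.
have : \sum_(x in S :\ p) 3 <= \sum_(x in S :\ p) #|nbh e S x|.
  by apply: leq_sum => x xS; have := noy x; rewrite xS -ltnNge.
rewrite sum_nat_const; have := cardsD1 p S; rewrite pS; lia.
Qed.

Lemma exists_small_degree e l S : 0 < #|S| -> sparse e l S ->
  exists2 y, y \in S & #|nbh e S y| * #|S| <= 2 * (#|S| + l).
Proof.
case/card_gt0P => x0 x0S spS.
case: (arg_minnP (fun x => #|nbh e S x|) x0S) => y yS ymin; exists y => //.
apply: leq_trans (spS S (subxx _)); rewrite mulnC -sum_nat_const.
exact: leq_sum.
Qed.

End Guest.

Section Embed.
Variables (V T : finType) (r : rel T).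
Hypothesis r_sym : symmetric r.
Implicit Types (e : rel V) (S : {set V}) (H : {set T}) (f : V -> T).

Definition blue x y := (x != y) && ~~ r x y.

Lemma blue_sym : symmetric blue.
Proof. by move=> x y; rewrite /blue eq_sym r_sym. Qed.

Lemma blueF x : blue x x = false.
Proof. by rewrite /blue eqxx. Qed.

Lemma blueN x y : x != y -> ~~ blue x y -> r x y.
Proof. by rewrite /blue => ->; rewrite negbK. Qed.

Definition bnb H x := [set y in H | blue x y].

Definition blue_le d H := {in H, forall x, #|bnb H x| <= d}.

Lemma bnbS H H' x : H \subset H' -> #|bnb H x| <= #|bnb H' x|.
Proof.
move=> sH; apply/subset_leq_card/subsetP => y; rewrite !inE => /andP[yX ->].
by rewrite (subsetP sH).
Qed.

Lemma blue_leS d H H' : H \subset H' -> blue_le d H' -> blue_le d H.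
Proof.
by move=> sH le x xH; apply: leq_trans (bnbS x sH) _; apply/le/(subsetP sH).
Qed.

Definition embeds e S H f :=
  [/\ {in S, forall x, f x \in H}, {in S &, injective f}
    & {in S &, forall x y, e x y -> r (f x) (f y)}].

Definition emb e S H := exists f, embeds e S H f.

Lemma embedsS e S H H' f : H \subset H' -> embeds e S H f -> embeds e S H' f.
Proof. by move=> sH [fH fI fe]; split=> // x xS; apply/(subsetP sH)/fH. Qed.

Lemma embS e S H H' : H \subset H' -> emb e S H -> emb e S H'.
Proof. by move=> sH [f Hf]; exists f; apply: embedsS Hf. Qed.

Lemma embeds_extend e S H f v u : symmetric e -> irreflexive e -> u \in H ->
    embeds e (S :\ v) H f -> u \notin f @: (S :\ v) ->
    {in S :\ v, forall y, e v y -> r u (f y)} ->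
  embeds e S H [eta f with v |-> u].
Proof.
move=> e_sym e_irr uH [fH fI fe] uN ue.
have inD y : y \in S -> y != v -> y \in S :\ v by move=> yS yv; rewrite !inE yv.
split=> [x xS|x y xS yS|x y xS yS] /=.
- by case: eqP => // /eqP xv; apply/fH/inD.
- case: eqP => [->|/eqP xv]; case: eqP => [->|/eqP yv] //.
  + by move=> uE; case/negP: uN; rewrite uE imset_f // inD.
  + by move=> uE; case/negP: uN; rewrite -uE imset_f // inD.
  + by apply: fI; apply: inD.
- case: eqP => [->|/eqP xv]; case: eqP => [->|/eqP yv].
  + by rewrite e_irr.
  + by apply: ue; apply: inD.
  + by rewrite e_sym r_sym; apply: ue; apply: inD.
  + by apply: fe; apply: inD.
Qed.

Lemma embeds_step e S H f d v : symmetric e -> irreflexive e -> v \in S ->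
    embeds e (S :\ v) H f -> blue_le d H ->
    #|S|.-1 + d * #|nbh e S v| < #|H| ->
  exists u, embeds e S H [eta f with v |-> u].
Proof.
move=> e_sym e_irr vS fE dH lt; have [fH fI fe] := fE.
pose Bad := f @: (S :\ v) :|: \bigcup_(y in nbh e S v) bnb H (f y).
have nbhD y : y \in nbh e S v -> y \in S :\ v.
  rewrite nbhE !inE => /andP[-> evy]; rewrite andbT.
  by apply: contraTneq evy => ->; rewrite e_irr.
have leBad : #|Bad| <= #|S|.-1 + d * #|nbh e S v|.
  apply: leq_trans (leq_card_setU _ _) _; apply: leq_add.
    by apply: leq_trans (leq_imset_card _ _) _; rewrite (cardsD1 v S) vS.
  by rewrite mulnC; apply: card_bigcup_le => y yn; apply/dH/fH/nbhD.
have [u uH uBad] := exists_notin (leq_ltn_trans leBad lt).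
move: uBad; rewrite inE negb_or => /andP[uN uB].
exists u; apply: embeds_extend => // y yS evy.
have yn : y \in nbh e S v by rewrite nbhE evy andbT; case/setD1P: yS.
rewrite r_sym; apply: blueN.
  by apply: contraNneq uN => <-; apply: imset_f.
apply: contra uB => b; apply/bigcupP; exists y => //.
by rewrite inE uH.
Qed.

Lemma greedy_embedding e S H d p v : symmetric e -> irreflexive e ->
    p \in S -> v \in H -> blue_le d H -> d.+1 * #|S|.-1 < #|H| ->
  exists2 f, embeds e S H f & f p = v.
Proof.
move=> e_sym e_irr; have [n] := ubnP #|S|; elim: n S => // n IHn S ltS pS vH dH lt.
have [Sp|[y yS]] := set_0Vmem (S :\ p).
  exists (fun=> v) => //; have S1 : {in S, forall x, x = p}.
    move=> x xS; apply/eqP/negPn/negP => xp.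
    by move/setP/(_ x): Sp; rewrite !inE xp xS.
  split=> // [x y /S1-> /S1-> //|x y /S1-> /S1->].
  by rewrite e_irr.
have [yp {}yS] := setD1P yS.
have cS := cardsD1 y S; rewrite yS in cS.
have [|||||f fE fp] := IHn (S :\ y) => //; try lia.
- by rewrite !inE eq_sym yp.
have [|u uE] := embeds_step e_sym e_irr yS fE dH.
  have := nbh_lt e_irr yS; nia.
by exists [eta f with y |-> u] => //=; rewrite eq_sym (negbTE yp).
Qed.

Lemma near_clique_embedding e l S H d p v : symmetric e -> irreflexive e ->
    sparse e l S -> p \in S -> v \in H -> blue_le d H ->
    #|S| + 2 * d <= #|H| -> d.+1 * (2 * l + 2) < #|H| ->
  exists2 f, embeds e S H f & f p = v.
Proof.
move=> e_sym e_irr; have [n] := ubnP #|S|; elim: n S => // n IHn S ltS spS pS vH dH le lt.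
have [leS|ltS'] := leqP #|S| (2 * l + 3).
  apply: (greedy_embedding (d := d)) => //; apply: leq_ltn_trans lt.
  by rewrite leq_mul2l; apply/orP; right; lia.
have [y /setD1P[yp yS] dy] := exists_degree_le2 pS spS ltS'.
have cS := cardsD1 y S; rewrite yS in cS.
have [|||||||f fE fp] := IHn (S :\ y) => //; try lia.
- by apply: sparseS spS; apply: subsetDl.
- by rewrite !inE eq_sym yp.
have [|u uE] := embeds_step e_sym e_irr yS fE dH; first nia.
by exists [eta f with y |-> u] => //=; rewrite eq_sym (negbTE yp).
Qed.

Lemma near_clique_emb e l S H d : symmetric e -> irreflexive e ->
    sparse e l S -> blue_le d H ->
    #|S| + 2 * d <= #|H| -> d.+1 * (2 * l + 2) < #|H| -> emb e S H.
Proof.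
move=> e_sym e_irr spS dH le lt.
have /card_gt0P[v vH] : 0 < #|H| by lia.
have [S0|[p pS]] := set_0Vmem S.
  by exists (fun=> v); split=> x; rewrite S0 inE.
have [f fE _] := near_clique_embedding e_sym e_irr spS pS vH dH le lt.
by exists f.
Qed.

End Embed.

Lemma exists_subset_card (T : finType) (A : {set T}) k : k <= #|A| ->
  exists2 P : {set T}, P \subset A & #|P| = k.
Proof.
move=> le; exists [set x in take k (enum A)].
  by apply/subsetP => x; rewrite inE => /mem_take; rewrite mem_enum.
rewrite cardsE (card_uniqP _) ?take_uniq ?enum_uniq // size_takel //.
by rewrite -cardE.
Qed.

Lemma card_setD_ge (T : finType) (A B : {set T}) : #|A| <= #|A :\: B| + #|B|.
Proof. by have := cardsID B A; have := subset_leq_card (subsetIr A B); lia. Qed.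

(** * Blue books and blue matchings *)

Section Books.
Variables (T : finType) (r : rel T).
Hypothesis r_sym : symmetric r.
Implicit Types (H D P C U Q X : {set T}).
Local Notation blue := (blue r).
Local Notation bnb := (bnb r).

Definition isbook k D := [exists a, exists b, exists P : {set T},
  [&& blue a b, #|P| == k, P \subset [set y | blue a y && blue b y]
    & D == a |: (b |: P)]].

Fixpoint books k t H := if t is t'.+1 then
  [exists D : {set T}, [&& isbook k D, D \subset H & books k t' (H :\: D)]]
  else true.

Definition nobook k H :=
  {in H &, forall a b, blue a b -> #|bnb H a :&: bnb H b| < k}.

Lemma isbookP k D : reflect (exists a b P, [/\ blue a b, #|P| = k,
    {in P, forall y, blue a y /\ blue b y} & D = a |: (b |: P)])
  (isbook k D).
Proof.
apply: (iffP existsP) => [[a /existsP[b /existsP[P /and4P[ab /eqP cP sP /eqP->]]]]|].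
  exists a, b, P; split=> // y /(subsetP sP).
  by rewrite inE => /andP.
case=> a [b [P [ab cP sP ->]]]; exists a; apply/existsP; exists b.
apply/existsP; exists P; rewrite ab cP !eqxx /= andbT.
by apply/subsetP => y /sP[ay by_]; rewrite inE ay.
Qed.

Lemma isbook_card k D : isbook k D -> #|D| = k + 2.
Proof.
case/isbookP => a [b [P [ab cP sP ->]]].
rewrite !cardsU1 cP !inE negb_or.
have -> : a \notin P by apply/negP => /sP[]; rewrite blueF.
have -> : b \notin P by apply/negP => /sP[]; rewrite blueF.
by case/andP: ab => -> _; rewrite /=; lia.
Qed.

Lemma nobook_intro k H :
  (forall D, isbook k D -> D \subset H -> False) -> nobook k H.
Proof.
move=> noD a b aH bH ab; rewrite ltnNge; apply/negP => /exists_subset_card[P sP cP].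
have PP y : y \in P -> [/\ y \in H, blue a y & blue b y].
  by move/(subsetP sP); rewrite !inE => /andP[/andP[-> ->] /andP[]].
apply: (noD (a |: (b |: P))).
  by apply/isbookP; exists a, b, P; split=> // y /PP[].
apply/subsetP => y; rewrite !inE => /or3P[/eqP->|/eqP->|/PP[]] //.
Qed.

Lemma nobookP k H D : nobook k H -> isbook k D -> D \subset H -> False.
Proof.
move=> nb /isbookP[a [b [P [ab cP sP ->]]]]; rewrite !subUset !sub1set.
move=> /and3P[aH bH PH]; have := nb a b aH bH ab; rewrite -cP ltnNge.
case/negP; apply/subset_leq_card/subsetP => y yP.
by have [ay by_] := sP y yP; rewrite !inE (subsetP PH) // ay.
Qed.

Lemma nobook_blue_le k H a : nobook k H -> a \in H -> blue_le r k.-1 (bnb H a).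
Proof.
move=> nb aH b; rewrite inE => /andP[bH ab].
have -> : bnb (bnb H a) b = bnb H a :&: bnb H b.
  by apply/setP => y; rewrite !inE; case: (y \in H).
by have := nb a b aH bH ab; case: k {nb}.
Qed.

Lemma booksS k t H H' : H \subset H' -> books k t H -> books k t H'.
Proof.
elim: t H H' => //= t IHt H H' sH /existsP[D /and3P[bD sD bt]].
apply/existsP; exists D; rewrite bD (subset_trans sD sH) /=.
by apply: IHt bt; apply: setSD.
Qed.

Lemma books_cons k t H D : isbook k D -> D \subset H -> books k t (H :\: D) ->
  books k t.+1 H.
Proof. by move=> bD sD bt; apply/existsP; exists D; rewrite bD sD. Qed.

Lemma max_books k t H : ~~ books k t H ->
  exists F : {set T}, [/\ F \subset H, #|F| <= t.-1 * (k + 2) & nobook k (H :\: F)].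
Proof.
elim: t H => //= t IHt H; rewrite negb_exists => /forallP nbk.
case: (boolP [exists D, isbook k D && (D \subset H)]) => [/existsP[D /andP[bD sD]]|].
  have := nbk D; rewrite bD sD /= => nbt.
  have [F [sF cF nF]] := IHt _ nbt; exists (D :|: F); split.
  - by rewrite subUset sD (subset_trans sF) ?subsetDl.
  - apply: leq_trans (leq_card_setU _ _) _; rewrite (isbook_card bD).
    by case: t nbt cF {IHt nbk} => //= t _; rewrite mulSn; lia.
  - by rewrite -setDDl.
rewrite negb_exists => /forallP noD; exists set0; split; rewrite ?sub0set ?cards0 //.
by rewrite setD0; apply: nobook_intro => D bD sD; have := noD D; rewrite bD sD.
Qed.

Lemma blue_clique_books k t C : {in C &, forall x y, x != y -> blue x y} ->
  t * (k + 2) <= #|C| -> books k t C.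
Proof.
elim: t C => // t IHt C cC; rewrite mulSn => le.
have [D sD cD] : exists2 D : {set T}, D \subset C & #|D| = k + 2.
  by apply: exists_subset_card; lia.
have bC x y : x \in D -> y \in D -> x != y -> blue x y.
  by move=> xD yD; apply: cC; apply: (subsetP sD).
apply: (books_cons (D := D)) => //.
  have /card_gt0P[a aD] : 0 < #|D| by lia.
  have cDa := cardsD1 a D; rewrite aD in cDa.
  have /card_gt0P[b bDa] : 0 < #|D :\ a| by lia.
  have cDb := cardsD1 b (D :\ a); rewrite bDa in cDb.
  have [ba bD] := setD1P bDa.
  apply/isbookP; exists a, b, (D :\ a :\ b); split.
  - by apply: bC => //; rewrite eq_sym.
  - by lia.
  - move=> y /setD1P[yb /setD1P[ya yD]].
    by split; apply: bC => //; rewrite eq_sym.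
  - by rewrite !setD1K.
apply: IHt => [x y /setDP[xC _] /setDP[yC _]|]; first exact: cC.
by have := card_setD_ge C D; lia.
Qed.

Fixpoint bmatch t U := if t is t'.+1 then
  [exists a, exists b, [&& a \in U, b \in U, blue a b & bmatch t' (U :\ a :\ b)]]
  else true.

Lemma bmatchS t U U' : U \subset U' -> bmatch t U -> bmatch t U'.
Proof.
elim: t U U' => //= t IHt U U' sU /existsP[a /existsP[b /and4P[aU bU ab bt]]].
apply/existsP; exists a; apply/existsP; exists b.
rewrite !(subsetP sU) //= ab /=; apply: IHt bt.
by do 2!apply: setSD.
Qed.

Lemma bmatch_books k t c U Q : bmatch t U -> [disjoint U & Q] ->
    {in U, forall u, #|[set x in Q | ~~ blue u x]| <= c} ->
    t * k + 2 * c <= #|Q| -> books k t (U :|: Q).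
Proof.
elim: t U Q => // t IHt U Q /existsP[a /existsP[b /and4P[aU bU ab bt]]] dUQ dQ.
rewrite mulSn => le.
pose Q' := Q :\: ([set x in Q | ~~ blue a x] :|: [set x in Q | ~~ blue b x]).
have [P sP cP] : exists2 P : {set T}, P \subset Q' & #|P| = k.
  apply: exists_subset_card.
  have := card_setD_ge Q ([set x in Q | ~~ blue a x] :|: [set x in Q | ~~ blue b x]).
  have := (leq_card_setU [set x in Q | ~~ blue a x] [set x in Q | ~~ blue b x]).1.
  by have := dQ a aU; have := dQ b bU; rewrite -/Q'; lia.
have PP y : y \in P -> [/\ y \in Q, blue a y & blue b y].
  move/(subsetP sP); rewrite !inE => /andP[]; case: (y \in Q) => //=.
  by rewrite negb_or !negbK => /andP[].
have UnQ x : x \in U -> x \notin Q by move=> xU; rewrite (disjointFr dUQ).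
apply: (books_cons (D := a |: (b |: P))).
- by apply/isbookP; exists a, b, P; split=> // y /PP[].
- rewrite !subUset !sub1set !inE aU bU /=.
  by apply/subsetP => y /PP[yQ _ _]; rewrite inE yQ orbT.
apply: (@booksS _ _ ((U :\ a :\ b) :|: (Q :\: P))).
  apply/subsetP => x; rewrite !inE !negb_or => /orP[/and3P[xb xa xU]|/andP[xP xQ]].
    by rewrite xa xb xU /= andbT; apply: contra (UnQ x xU) => /PP[].
  rewrite xP xQ orbT !andbT; apply/andP.
  by split; apply: contraTneq xQ => ->; apply: UnQ.
apply: IHt => //.
- rewrite -setI_eq0 -subset0; apply/subsetP => x; rewrite !inE.
  by move=> /andP[/and3P[_ _ /UnQ/negP xQ] /andP[_ /xQ]].
- move=> u; rewrite !inE => /and3P[_ _ uU]; apply: leq_trans (dQ u uU).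
  by apply/subset_leq_card/subsetP => y; rewrite !inE => /andP[/andP[_ ->] ->].
- have := cardsID P Q; have -> : Q :&: P = P by apply/setIidPr/subsetP => y /PP[].
  by lia.
Qed.

(* [X] is the set missed by a maximum matching; by maximality an edge of the
   matching cannot have blue neighbours in [X] at both ends, except a common
   one. *)
Lemma bmatch_structure m U : bmatch m U -> ~~ bmatch m.+1 U ->
  exists X Ex : {set T}, [/\ X \subset U, Ex \subset U :\: X,
    #|U| = #|X| + 2 * m, #|Ex| = m
    & [/\ bmatch m (U :\: X), {in X &, forall x y, ~~ blue x y}
      & {in Ex, forall z, #|bnb X z| <= 1}]].
Proof.
elim: m U => [|m IHm] U.
  move=> _ /existsPn nob; exists U, set0; split; rewrite ?cards0 ?sub0set ?addn0 //.
  split=> // [x y xU yU|z]; last by rewrite inE.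
  by have /existsPn/(_ y) := nob x; rewrite xU yU andbT.
case/existsP=> a /existsP[b /and4P[aU bU ab bm]] nobm.
pose U' := U :\ a :\ b.
have ab' : a != b by case/andP: ab.
have nb : ~~ bmatch m.+1 U'.
  apply: contra nobm => h; apply/existsP; exists a; apply/existsP; exists b.
  by rewrite aU bU ab.
have [X [Ex [sX sEx cX cEx [mX rX bEx]]]] := IHm _ bm nb.
have inU' x : x \in U' -> [/\ x != a, x != b & x \in U].
  by rewrite !inE => /and3P[-> -> ->].
have inX x : x \in X -> [/\ x != a, x != b & x \in U].
  by move/(subsetP sX)/inU'.
have cU : #|U| = #|U'|.+2.
  by rewrite (cardsD1 a U) (cardsD1 b (U :\ a)) !inE eq_sym ab' aU bU.
have aX : a \notin X by apply/negP => /inX[]; rewrite eqxx.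
have bX : b \notin X by apply/negP => /inX[_]; rewrite eqxx.
have sub : U' :\: X \subset (U :\: X) :\ a :\ b.
  by apply/subsetP => x; rewrite !inE => /and4P[-> -> -> ->].
have mXU : bmatch m.+1 (U :\: X).
  apply/existsP; exists a; apply/existsP; exists b.
  by rewrite !inE aU bU aX bX ab /=; apply: bmatchS mX.
have [z [zab zX]] : exists z, (z == a) || (z == b) /\ #|bnb X z| <= 1.
  have [leA|gtA] := leqP #|bnb X a| 1; first by exists a; rewrite eqxx.
  have [leB|gtB] := leqP #|bnb X b| 1; first by exists b; rewrite eqxx orbT.
  have /card_gt0P[c] := ltnW gtA.
  rewrite inE => /andP[cX' ac].
  have [d dB dc] : exists2 d, d \in bnb X b & d \notin [set c].
    by apply: exists_notin; rewrite cards1.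
  move: dB dc; rewrite !inE => /andP[dX bd] dc.
  have [ca cb cU'] := inX c cX'; have [da db dU] := inX d dX.
  case/negP: nobm; apply/existsP; exists a; apply/existsP; exists c.
  rewrite aU cU' ac /=; apply/existsP; exists b; apply/existsP; exists d.
  rewrite !inE bd bU dU da dc eq_sym cb eq_sym ab' /=.
  apply: bmatchS mX; apply/subsetP => x; rewrite !inE => /and4P[xX xb xa xU].
  rewrite xa xb xU !andbT; apply/andP.
  by split; apply: contraNneq xX => ->.
have zU : z \in U by case/orP: zab => /eqP->.
have zU' : z \notin U'.
  by apply/negP => /inU'[za zb _]; move: zab; rewrite (negbTE za) (negbTE zb).
have zNX : z \notin X by apply: contra zU' => /(subsetP sX).
exists X, (z |: Ex); split=> //.
- by apply: subset_trans sX _; apply/subsetP => x /inU'[].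
- rewrite subUset sub1set inE zNX zU /=; apply: subset_trans sEx _.
  by apply/subsetP => x; rewrite !inE => /and4P[-> _ _ ->].
- by rewrite cU cX mulnS addnCA add2n.
- rewrite cardsU1 cEx; have -> : z \notin Ex; last by [].
  by apply: contra zU' => /(subsetP sEx); rewrite inE => /andP[].
split=> // x; rewrite in_setU1 => /orP[/eqP->|] //; exact: bEx.
Qed.

Lemma bmatch_max t U : ~~ bmatch t U ->
  exists2 m, m < t & bmatch m U && ~~ bmatch m.+1 U.
Proof.
elim: t => // t IHt nb; case: (boolP (bmatch t U)) => [mt|/IHt[m lt h]].
  by exists t; rewrite // mt.
by exists m => //; apply: ltn_trans lt _.
Qed.

End Books.

Lemma exists_injection (V T : finType) (A : {set V}) (B : {set T}) (z : T) :
  #|A| <= #|B| ->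
  exists2 h : V -> T, {in A, forall x, h x \in B} & {in A &, injective h}.
Proof.
move=> le; have szB x : x \in A -> index x (enum A) < size (enum B).
  move=> xA; apply: leq_trans (_ : size (enum A) <= _); last by rewrite -!cardE.
  by rewrite index_mem mem_enum.
exists (fun x => nth z (enum B) (index x (enum A))) => [x xA|x y xA yA].
  by rewrite -mem_enum mem_nth ?szB.
move/eqP; rewrite nth_uniq ?enum_uniq ?szB // => /eqP.
by move/(congr1 (nth x (enum A))); rewrite !nth_index ?mem_enum.
Qed.

Section Exact.
Variables (V T : finType) (r : rel T) (e : rel V).
Hypothesis r_sym : symmetric r.
Hypotheses (e_sym : symmetric e) (e_irr : irreflexive e).
Implicit Types (S Low I : {set V}) (H U W : {set T}).
Local Notation blue := (blue r).
Local Notation bnb := (bnb r).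

Lemma exists_independent S Low j : Low \subset S ->
    {in Low, forall v, #|nbh e S v| <= 2} -> 3 * j <= #|Low| ->
  exists I : {set V}, [/\ I \subset Low, #|I| = j & {in I &, forall x y, ~~ e x y}].
Proof.
elim: j Low => [|j IHj] Low sLow low2 le.
  by exists set0; rewrite sub0set cards0; split=> // x y; rewrite inE.
have /card_gt0P[v vL] : 0 < #|Low| by lia.
pose B := v |: nbh e S v.
have cB : #|B| <= 3.
  by rewrite cardsU1; have := low2 v vL; case: (v \notin _); lia.
have [|||I [sI cI Iind]] := IHj (Low :\: B).
- by apply: subset_trans sLow; apply: subsetDl.
- by move=> x /setDP[/low2].
- by have := card_setD_ge Low B; lia.
have IB x : x \in I -> [/\ x \in Low, x != v & ~~ e v x].
  move/(subsetP sI); rewrite !inE negb_or => /andP[/andP[xv nex] xL].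
  by split=> //; apply: contra nex => ->; rewrite (subsetP sLow).
exists (v |: I); split.
- by rewrite subUset sub1set vL; apply/subsetP => x /IB[].
- by rewrite cardsU1 cI; case: (boolP (v \in I)) => [/IB[_]|_]; rewrite ?eqxx.
move=> x y; rewrite !in_setU1 => /orP[/eqP->|xI] /orP[/eqP->|yI].
- by rewrite e_irr.
- by have [] := IB y yI.
- by rewrite e_sym; have [] := IB x xI.
- exact: Iind.
Qed.

Lemma exists_low l S : sparse e l S ->
  #|S| <= 3 * #|[set v in S | #|nbh e S v| <= 2]| + 2 * l.
Proof.
move=> spS; have := spS S (subxx _); rewrite /degree_sum.
set L := [set v in S | _]; rewrite (big_setID L) /=.
have : \sum_(x in S :\: L) 3 <= \sum_(x in S :\: L) #|nbh e S x|.
  by apply: leq_sum => x; rewrite !inE; case: (x \in S) => //=; lia.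
rewrite sum_nat_const; have := cardsID L S.
have -> : S :&: L = L by apply/setIidPr/subsetP => x; rewrite inE => /andP[].
by lia.
Qed.

(* The extra vertices [Ex] receive independent guest vertices of degree at most
   2, whose neighbours avoid the few blue neighbours [C] of [Ex]. *)
Lemma near_complete_emb l S U t : sparse e l S -> ~~ bmatch r t U ->
  #|S| + t.-1 <= #|U| -> 2 * l + 9 * t <= #|S| -> emb r e S U.
Proof.
move=> spS nbt leU leS.
have [m ltm /andP[mm nm]] := bmatch_max nbt.
have [X [Ex [sX sEx cX cEx [_ rX bEx]]]] := bmatch_structure mm nm.
have := exists_low spS; set Low := [set v in S | _] => cLow.
have [|||I [sI cI Iind]] := @exists_independent S Low m.
- by apply/subsetP => v; rewrite inE => /andP[].
- by move=> v; rewrite inE => /andP[].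
- by lia.
have inI v : v \in I -> v \in S /\ #|nbh e S v| <= 2.
  by move/(subsetP sI); rewrite inE => /andP[].
have sIS : I \subset S by apply/subsetP => v /inI[].
pose N := \bigcup_(v in I) nbh e S v.
have cN : #|N| <= m * 2.
  by rewrite -cI; apply: card_bigcup_le => v /inI[].
have NP v : v \in N -> v \in S :\: I.
  case/bigcupP => w wI; rewrite !inE => /andP[-> ewv]; rewrite andbT.
  by apply: contraTN ewv => /(Iind _ _ wI).
pose C := \bigcup_(z in Ex) bnb X z.
have cC : #|C| <= m * 1 by rewrite -cEx; apply: card_bigcup_le.
have sC : C \subset X.
  by apply/subsetP => x /bigcupP[z _]; rewrite inE => /andP[].
have cSI : #|S :\: I| + m = #|S|.
  by rewrite -(cardsID I S) (setIidPr sIS) cI addnC.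
have cXC := card_setD_ge X C; clear nbt mm nm.
have /card_gt0P[z0 _] : 0 < #|X| by lia.
have [|g gE gI] := @exists_injection _ _ I Ex z0; first by rewrite cI cEx.
have [|h1 h1E h1I] := @exists_injection _ _ N (X :\: C) z0; first by lia.
have [|h2 h2E h2I] := @exists_injection _ _ (S :\: I :\: N) (X :\: (h1 @: N)) z0.
  have sN : N \subset S :\: I by apply/subsetP => v /NP.
  have := cardsID N (S :\: I); rewrite (setIidPr sN).
  have := card_setD_ge X (h1 @: N); have := leq_imset_card h1 N.
  by lia.
pose f v := if v \in I then g v else if v \in N then h1 v else h2 v.
have fX v : v \in S -> v \notin I -> f v \in X.
  move=> vS vI; rewrite /f (negbTE vI); case: ifP => vN.
    by have /setDP[] := h1E v vN.
  by have /setDP[] : h2 v \in X :\: (h1 @: N) by apply: h2E; rewrite !inE vN vI.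
have fE v : v \in I -> f v \in Ex by move=> vI; rewrite /f vI; apply: gE.
have ExX v w : v \in X -> w \in Ex -> v != w.
  move=> vX /(subsetP sEx)/setDP[_ wX].
  by apply: contraNneq wX => <-.
have fI : {in S &, injective f}.
  move=> x y xS yS; case: (boolP (x \in I)) (boolP (y \in I)) => xI [] yI.
  - by rewrite /f xI yI; apply: gI.
  - by move/eqP; rewrite eq_sym (negbTE (ExX _ _ (fX y yS yI) (fE x xI))).
  - by move/eqP; rewrite (negbTE (ExX _ _ (fX x xS xI) (fE y yI))).
  rewrite /f (negbTE xI) (negbTE yI); case: ifP => xN; case: ifP => yN.
  - exact: h1I.
  - have : h2 y \in X :\: (h1 @: N) by apply: h2E; rewrite !inE yN yI.
    by case/setDP=> _ + fxy; rewrite -fxy imset_f.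
  - have : h2 x \in X :\: (h1 @: N) by apply: h2E; rewrite !inE xN xI.
    by case/setDP=> _ + fxy; rewrite fxy imset_f.
  - by apply: h2I; rewrite !inE ?xN ?yN ?xI ?yI.
have cross x y : x \in I -> y \in S -> e x y -> r (f x) (f y).
  move=> xI yS exy.
  have yI : y \notin I by apply: contraTN exy => /(Iind _ _ xI).
  have yN : y \in N by apply/bigcupP; exists x => //; rewrite nbhE yS.
  apply: blueN; first by rewrite eq_sym ExX ?fX ?fE.
  have /setDP[_] : f y \in X :\: C by rewrite /f (negbTE yI) yN; apply: h1E.
  apply: contra => b; apply/bigcupP; exists (f x); first exact: fE.
  by rewrite inE fX.
exists f; split=> // [x xS|x y xS yS exy].
  case: (boolP (x \in I)) => xI; last exact: (subsetP sX _ (fX x xS xI)).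
  by have /setDP[] := subsetP sEx _ (fE x xI).
case: (boolP (x \in I)) => xI; first exact: cross.
case: (boolP (y \in I)) => yI; first by rewrite r_sym cross // e_sym.
apply: blueN; last exact: rX (fX _ _ _) (fX _ _ _).
by apply: contraTneq exy => /(fI _ _ xS yS) ->; rewrite e_irr.
Qed.

(* With [a] the maximal blue degree, the first [a / k] vertices go into a blue
   neighbourhood of size [a]; afterwards the least degree [d] of the remaining
   subgraph satisfies [a * d <= 2 * a + 2 * k * l]. *)
Lemma crude_emb k l S W : 0 < k -> nobook r k W -> sparse e l S ->
  3 * #|S| + 4 * k + 6 * (k * l) <= #|W| -> emb r e S W.
Proof.
move=> k0 nbW spS leW.
have /card_gt0P[w0 w0W] : 0 < #|W| by lia.
case: (arg_maxnP (fun w => #|bnb W w|) w0W) => v vW vmax.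
set A := bnb W v in vmax; set a := #|A| in vmax.
have sAW : A \subset W by apply/subsetP => x; rewrite inE => /andP[].
have blA : blue_le r k.-1 A by apply: nobook_blue_le.
have blW : blue_le r a W by move=> x /vmax.
have [/andP[h1 h2]|hA] := boolP ((#|S| + 2 * k <= a) && (k * (2 * l + 2) < a)).
  apply: embS sAW _; apply: (near_clique_emb r_sym e_sym e_irr spS blA).
    by rewrite -/a; lia.
  by rewrite prednK.
have lea : a <= #|S| + 2 * k + 2 * (k * l).
  move: hA; rewrite negb_and -ltnNge -leqNgt => /orP[]; nia.
have {leW lea hA} lt : #|S| + 2 * a + 2 * (k * l) <= #|W| by lia.
elim: {S}_.+1 {-2}S (ltnSn #|S|) spS lt => // n IHn S ltS spS lt.
have [S0|[p pS]] := set_0Vmem S.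
  by exists (fun=> w0); split=> x; rewrite S0 inE.
have S_gt0 : 0 < #|S| by apply/card_gt0P; exists p.
have [ltA|leA] := ltnP (k * #|S|.-1) a.
  have /card_gt0P[u uA] : 0 < #|A| by apply: leq_ltn_trans ltA.
  apply: embS sAW _.
  have [|f fE _] := greedy_embedding r_sym e_sym e_irr pS uA blA.
    by rewrite prednK.
  by exists f.
have [y yS dy] := exists_small_degree S_gt0 spS.
have cS := cardsD1 y S; rewrite yS in cS.
have [|||f fE] := IHn (S :\ y); try lia.
  by apply: sparseS spS; apply: subsetDl.
have [|u uE] := embeds_step r_sym e_sym e_irr yS fE blW; last by exists [eta f with y |-> u].
suff : a * #|nbh e S y| <= 2 * a + 2 * (k * l) by lia.
rewrite -(leq_pmul2r S_gt0); nia.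
Qed.

End Exact.

(** * Suspended paths in sparse connected graphs *)

Section Suspended.
Variables (V : finType) (e : rel V).
Hypotheses (e_sym : symmetric e) (e_irr : irreflexive e).
Implicit Types (S X L : {set V}) (p : seq V).

Definition leaves S := [set x in S | #|nbh e S x| == 1].

Definition suspended S p := [/\ uniq p, {subset p <= S}, sorted e p
  & forall x0 i z, i.+2 < size p -> z \in S -> e (nth x0 p i.+1) z ->
      z = nth x0 p i \/ z = nth x0 p i.+2].

Lemma conn_degree_gt0 S x : conn e S -> 1 < #|S| -> x \in S -> 0 < #|nbh e S x|.
Proof.
move=> cS lt xS; rewrite lt0n; apply: contraTN lt => /eqP/cards0_eq nb0.
have <- : [set x] = S; last by rewrite cards1.
apply: cS => [|| y z]; first by rewrite sub1set.
  by apply/set0Pn; exists x; rewrite set11.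
move=> /set1P-> zS exz; have : z \in nbh e S x by rewrite nbhE zS.
by rewrite nb0 in_set0.
Qed.

Lemma conn_remove_leaves S L : conn e S -> L \subset leaves S ->
  conn e (S :\: L).
Proof.
move=> cS sL X sX X0 clX.
pose X' := X :|: [set y in L | [exists x in X, e x y]].
have sXS : X \subset S by apply: subset_trans sX (subsetDl _ _).
have LS y : y \in L -> y \in S /\ #|nbh e S y| = 1.
  by move/(subsetP sL); rewrite inE => /andP[-> /eqP].
have XS : X' = S.
  apply: cS.
  - by rewrite subUset sXS; apply/subsetP => y; rewrite inE => /andP[/LS[]].
  - by apply: contraNneq X0 => X'0; rewrite -subset0 -X'0 subsetUl.
  move=> x y; rewrite !inE => /orP[xX|/andP[xL /existsP[z /andP[zX ezx]]]] yS exy.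
    case: (boolP (y \in L)) => yL.
      by apply/orP; right; rewrite andTb; apply/existsP; exists x; rewrite xX.
    by rewrite (clX x) // inE yL.
  have [xS /eqP/cards1P[u nbx]] := LS x xL.
  have : y \in nbh e S x by rewrite nbhE yS.
  have : z \in nbh e S x by rewrite nbhE (subsetP sXS) // e_sym.
  by rewrite nbx => /set1P<- /set1P->; rewrite zX.
apply/eqP; rewrite eqEsubset sX; apply/subsetP => y /setDP[].
by rewrite -XS !inE => /orP[//|/andP[-> _]].
Qed.

(* Contraction of an edge at a vertex [b] of degree 2 with neighbours [a], [c]:
   this relation restricted to [S :\ b]. *)
Definition contract a c : rel V :=
  fun x y => [|| e x y, (x == a) && (y == c) | (x == c) && (y == a)].

Lemma contract_sym a c : symmetric (contract a c).
Proof.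
move=> x y; rewrite /contract e_sym; case: (e y x) => //=.
by rewrite orbC [(x == c) && _]andbC [(x == a) && _]andbC.
Qed.

Lemma contract_irr a c : a != c -> irreflexive (contract a c).
Proof.
move=> ac x; rewrite /contract e_irr /=; case: eqP => [->|] //=.
  by rewrite (negbTE ac).
by rewrite andbF.
Qed.

Lemma conn_contract S a b c : conn e S -> e a b ->
    {in S, forall z, e b z -> z = a \/ z = c} -> a \in S -> b \in S ->
  a != b -> conn (contract a c) (S :\ b).
Proof.
move=> cS eab nbb aS bS ab X sX X0 clX.
pose X' := if a \in X then b |: X else X.
have sXS : X \subset S by apply: subset_trans sX (subsetDl _ _).
have XX' : X \subset X' by rewrite /X'; case: ifP => // _; apply: subsetUr.
have bX : b \notin X by apply/negP => /(subsetP sX); rewrite !inE eqxx.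
have cX z : c = z -> z \in S :\ b -> (a \in X) = (z \in X).
  move=> <- cSb; apply/idP/idP => [aX|cX].
    by apply: (clX a c aX cSb); rewrite /contract !eqxx orbT.
  by apply: (clX c a cX); rewrite ?inE ?ab //= /contract !eqxx !orbT.
have XS : X' = S.
  apply: cS.
  - by rewrite /X'; case: ifP => // _; rewrite subUset sub1set bS.
  - by apply: contraNneq X0 => X'0; rewrite -subset0 -X'0.
  move=> x y; have [-> bX' yS eby|xb] := eqVneq x b; last first.
    move=> xX' yS exy.
    have xX : x \in X by move: xX'; rewrite /X'; case: ifP; rewrite // !inE (negbTE xb).
    have [yb|yb] := eqVneq y b; last first.
      by apply: (subsetP XX'); apply: (clX x) => //; rewrite ?inE ?yb //= /contract exy.
    have aX : a \in X.
      have [|xa|xc] := nbb x (subsetP sXS _ xX); rewrite ?xa // 1?e_sym -?yb //.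
        by rewrite -xa.
      by rewrite (cX x) // (subsetP sX).
    by rewrite /X' aX yb !inE eqxx.
  have sub : a \in X -> y \in X'.
    move=> aX; have [->|yc] := nbb y yS eby; first exact: (subsetP XX').
    apply: (subsetP XX'); rewrite -(cX y) // !inE yS andbT.
    by apply: contraTneq eby => ->; rewrite e_irr.
  by apply: sub; move: bX'; rewrite /X'; case: ifP; rewrite // (negbTE bX).
apply/eqP; rewrite eqEsubset sX; apply/subsetP => y.
rewrite in_setD1 -XS /X' => /andP[yb]; case: ifP => // _.
by rewrite in_setU1 (negbTE yb).
Qed.

Lemma degree_sumU1 X b : b \notin X ->
  degree_sum e (b |: X) = degree_sum e X + 2 * #|nbh e X b|.
Proof.
move=> bX; rewrite /degree_sum big_setU1 //=.
have -> : nbh e (b |: X) b = nbh e X b.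
  by apply/setP => y; rewrite !inE; case: eqP => // ->; rewrite e_irr !andbF.
have -> : \sum_(x in X) #|nbh e (b |: X) x| = \sum_(x in X) (#|nbh e X x| + e x b).
  apply: eq_bigr => x xX; rewrite addnC.
  rewrite -(cardsID [set b]) addnC [in RHS]addnC; congr (_ + _).
    congr #|pred_of_set _|; apply/setP => y; rewrite !inE.
    by case: eqP => //= ->; rewrite (negbTE bX).
  case: (boolP (e x b)) => exb.
    apply/eqP/cards1P; exists b; apply/setP => y; rewrite !inE.
    by case: eqP => [->|]; rewrite ?exb ?andbF.
  apply/eqP; rewrite cards_eq0; apply/eqP/setP => y; rewrite !inE.
  by case: eqP => [->|]; rewrite ?(negbTE exb) ?andbF.
rewrite big_split /= [X in _ + (_ + X)](_ : _ = #|nbh e X b|); first by lia.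
rewrite -sum1_card big_mkcond [in RHS]big_mkcond; apply: eq_bigr => x _.
by rewrite inE e_sym; case: (x \in X) => //=; case: (e b x).
Qed.

Lemma degree_sum_contract X a c : a != c ->
  degree_sum (contract a c) X
    <= degree_sum e X + (if (a \in X) && (c \in X) then 2 else 0).
Proof.
move=> ac; case: ifP => [/andP[aX cX]|acX]; last first.
  rewrite addn0; apply: leq_sum => x xX; apply/subset_leq_card/subsetP => y.
  rewrite !inE => /andP[yX]; rewrite yX /contract => /or3P[-> //||].
    by case/andP=> /eqP xa /eqP yc; rewrite -xa -yc xX yX in acX.
  by case/andP=> /eqP xc /eqP ya; rewrite -xc -ya xX yX in acX.
have cs z : z \in X -> \sum_(x in X) ((x == z) : nat) = 1.
  move=> zX; rewrite (bigD1 z) //= eqxx big1 ?addn0 // => x /andP[_].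
  by move/negbTE->.
apply: (@leq_trans (\sum_(x in X) (#|nbh e X x| + ((x == a) + (x == c))))).
  apply: leq_sum => x xX.
  pose E := [set y in X | ((x == a) && (y == c)) || ((x == c) && (y == a))].
  have -> : nbh (contract a c) X x = nbh e X x :|: E.
    by apply/setP => y; rewrite !inE /contract; case: (y \in X).
  apply: leq_trans (leq_card_setU _ _) _; rewrite leq_add2l.
  have [xa|xa] := eqVneq x a.
    apply: leq_trans (_ : #|[set c]| <= _); last by rewrite cards1.
    apply/subset_leq_card/subsetP => y.
    by rewrite !inE xa eqxx (negbTE ac) orbF => /andP[].
  have [xc|xc] := eqVneq x c.
    apply: leq_trans (_ : #|[set a]| <= _); last by rewrite cards1.
    by apply/subset_leq_card/subsetP => y; rewrite !inE (negbTE xa) xc eqxx => /andP[].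
  rewrite leqn0 cards_eq0; apply/eqP/setP => y.
  by rewrite !inE (negbTE xa) (negbTE xc) andbF.
by rewrite !big_split /= !cs.
Qed.

Lemma sparse_contract l S a b c : e a b -> e b c -> a != c -> b \in S ->
  sparse e l S -> sparse (contract a c) l (S :\ b).
Proof.
move=> eab ebc ac bS spS X sX.
have sXS : X \subset S by apply: subset_trans sX (subsetDl _ _).
have bX : b \notin X by apply/negP => /(subsetP sX); rewrite !inE eqxx.
apply: leq_trans (degree_sum_contract X ac) _.
case: ifP => [/andP[aX cX]|_]; last by rewrite addn0; apply: spS.
have sbX : b |: X \subset S by rewrite subUset sub1set bS.
have := spS _ sbX; rewrite degree_sumU1 // cardsU1 bX.
have : #|[set a; c]| <= #|nbh e X b|.
  apply/subset_leq_card/subsetP => y; rewrite !inE => /orP[]/eqP->.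
    by rewrite aX e_sym.
  by rewrite cX.
rewrite cards2 ac /=; clear; lia.
Qed.

Section Walk.
Variables (l : nat) (S : {set V}).
Hypotheses (cS : conn e S) (spS : sparse e l S) (S_gt1 : 1 < #|S|).

Let B := [set x in S | #|nbh e S x| != 2].

Let Bdeg := \sum_(x in B) #|nbh e S x|.

Lemma branch_bounds :
  #|B| <= 2 * l + 2 * #|leaves S| /\ Bdeg <= 6 * l + 4 * #|leaves S|.
Proof.
have deg0 x : x \in S -> 0 < #|nbh e S x| by apply: conn_degree_gt0.
have cB : #|B| = \sum_(x in S) (#|nbh e S x| != 2).
  by rewrite -sum1_card /B -big_mkcondr; apply: eq_bigl => x; rewrite inE.
have cL : #|leaves S| = \sum_(x in S) (#|nbh e S x| == 1).
  by rewrite -sum1_card -big_mkcondr; apply: eq_bigl => x; rewrite inE.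
have cD : Bdeg = \sum_(x in S) (#|nbh e S x| != 2) * #|nbh e S x|.
  rewrite /Bdeg big_mkcond [RHS]big_mkcond; apply: eq_bigr => x _; rewrite inE.
  by case: (x \in S) => //=; case: eqP => //=; rewrite mul1n.
have := spS (subxx S); rewrite /degree_sum cB cL cD => sp.
have s1 : \sum_(x in S) 1 = #|S| by rewrite sum1_card.
suff [h1 h2] :
    \sum_(x in S) (#|nbh e S x| != 2) + 2 * (\sum_(x in S) 1)
      <= \sum_(x in S) #|nbh e S x| + 2 * \sum_(x in S) (#|nbh e S x| == 1)
  /\ \sum_(x in S) (#|nbh e S x| != 2) * #|nbh e S x| + 6 * (\sum_(x in S) 1)
      <= 3 * (\sum_(x in S) #|nbh e S x|)
         + 4 * \sum_(x in S) (#|nbh e S x| == 1).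
  by rewrite s1 in h1 h2; move: sp h1 h2; clear; lia.
rewrite !big_distrr /= -!big_split /=.
split; apply: leq_sum => x /deg0; case: (#|nbh e S x|) => [|[|[|m]]] //= _; lia.
Qed.

(* A layer around [B] consists of vertices of degree 2, each with a neighbour
   in the previous layer, so the layers never grow. *)
Fixpoint ball i := if i is i'.+1
  then ball i' :|: [set y in S | [exists x in ball i', e x y]] else B.

Let boundary X := \sum_(x in X) #|nbh e (S :\: X) x|.

Lemma ball_bounds i : [/\ B \subset ball i, ball i \subset S,
  #|ball i| <= #|B| + i * Bdeg & boundary (ball i) <= Bdeg].
Proof.
elim: i => [|i [sB sS le1 le2]] /=.
  split; rewrite ?mul0n ?addn0 //.
    by apply/subsetP => x; rewrite inE => /andP[].
  by apply: leq_sum => x _; apply: nbhS; apply: subsetDl.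
set X := ball i in sB sS le1 le2 *; set X' := X :|: _.
have sX' : X' \subset S.
  by rewrite subUset sS; apply/subsetP => x; rewrite inE => /andP[].
pose Y := X' :\: X.
have cX' : #|X'| = #|X| + #|Y|.
  by rewrite -(cardsID X X') (setIidPr _) // subsetUl.
have cY : #|Y| <= boundary X.
  apply: (@leq_trans #|\bigcup_(x in X) nbh e (S :\: X) x|).
    apply/subset_leq_card/subsetP => y /setDP[+ yX].
    rewrite inE (negbTE yX) inE => /andP[yS /existsP[x /andP[xX exy]]].
    by apply/bigcupP; exists x => //; rewrite nbhE exy inE yX yS.
  rewrite /boundary; elim/big_rec2: _ => [|x m Z xX leZ]; first by rewrite cards0.
  by apply: leq_trans (leq_card_setU _ _) _; rewrite leq_add2l.
split; rewrite ?(subset_trans sB) ?subsetUl //.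
  by rewrite cX' mulSn; move: cY le1 le2; clear; lia.
apply: leq_trans le2; apply: leq_trans cY.
rewrite /boundary (big_setID X) /= (setIidPr (subsetUl _ _)) big1 => [|x xX].
  rewrite add0n -sum1_card; apply: leq_sum => y /setDP[yX' yX].
  have yS : y \in S by apply: (subsetP sX').
  have dy : #|nbh e S y| = 2.
    apply/eqP; apply: contraNT yX => dy; apply: (subsetP sB).
    by rewrite inE yS.
  move: yX'; rewrite inE (negbTE yX) inE => /andP[_ /existsP[x /andP[xX exy]]].
  have xn : x \in nbh e S y by rewrite nbhE (subsetP sS) // e_sym.
  have := cardsD1 x (nbh e S y); rewrite xn dy => -[c1]; rewrite c1.
  apply/subset_leq_card/subsetP => z; rewrite !inE negb_or.
  case/andP=> /andP[/andP[zX _] zS] -> /=; rewrite zS !andbT.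
  by apply: contraNneq zX => ->.
apply/eqP; rewrite cards_eq0; apply/eqP/setP => z; rewrite !inE negb_or.
apply/negP => /andP[/andP[/andP[zX +] zS] exz]; rewrite zS /= => /existsP[].
by exists x; rewrite xX.
Qed.

Lemma exists_suspended q :
    2 * l + 2 * #|leaves S| + q * (6 * l + 4 * #|leaves S|) < #|S| ->
    q.+1 < #|S| ->
  exists2 p, suspended S p & size p = q.+2.
Proof.
move=> ltS ltq; have [bB bD] := branch_bounds.
have [_ _ cb _] := ball_bounds q.
have [v vS vb] : exists2 v, v \in S & v \notin ball q.
  apply: exists_notin; apply: leq_ltn_trans ltS.
  by apply: leq_trans cb _; apply: leq_add bB _; rewrite leq_mul2l bD orbT.
have deg2 i x : x \in S -> x \notin ball i -> #|nbh e S x| = 2.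
  move=> xS; have [/subsetP sB _ _ _] := ball_bounds i.
  by move=> xb; apply/eqP; apply: contraNT xb => dx; apply: sB; rewrite inE xS.
have far i x y : x \in S -> x \notin ball i.+1 -> e x y -> y \notin ball i.
  move=> xS + exy; apply: contra => yb; rewrite /= inE inE xS /=.
  by apply/orP; right; apply/existsP; exists y; rewrite yb e_sym.
have /card_gt0P[w wv] : 0 < #|nbh e S v| by rewrite (deg2 q).
pose next x y := odflt y [pick z in nbh e S y :\ x].
pose st n := iter n (fun s => (s.2, next s.1 s.2)) (v, w).
pose X n := (st n).1.
have Xnext n : #|nbh e S (X n.+1)| = 2 -> X n.+2 \in nbh e S (X n.+1) :\ X n.
  move=> d2; rewrite {1}/X /= -/(st n) /next; case: pickP => //= noz.
  have E : #|nbh e S (X n.+1) :\ X n| = 0 by apply: eq_card0 => z; apply: noz.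
  by have := cardsD1 (X n) (nbh e S (X n.+1)); rewrite d2 E; case: (_ \in _).
have inv n : n <= q ->
    [/\ X n \in S, X n \notin ball (q - n) & X n.+1 \in nbh e S (X n)].
  elim: n => [|n IHn] leq; first by rewrite subn0; split.
  have [XS Xb] := IHn (ltnW leq); rewrite nbhE => /andP[X1S e1].
  have X1b : X n.+1 \notin ball (q - n.+1).
    by apply: far e1; rewrite // subnSK.
  split=> //; have [] := setD1P (Xnext n _); last by [].
  exact: deg2 X1b.
have XS n : n <= q.+1 -> X n \in S.
  rewrite leq_eqVlt => /orP[/eqP->|/inv[]//].
  by have [_ _] := inv q (leqnn q); rewrite nbhE => /andP[].
have Xe n : n <= q -> e (X n) (X n.+1).
  by move/inv=> [_ _]; rewrite nbhE => /andP[].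
have Xd n : n <= q -> #|nbh e S (X n)| = 2.
  by move/inv=> [xS xb _]; apply: deg2 xb.
have Xback n : n < q -> X n.+2 != X n.
  by move=> lt; have /setD1P[] := Xnext n (Xd _ lt).
have Xnb n z : n < q -> z \in S -> e (X n.+1) z -> z = X n \/ z = X n.+2.
  move=> lt zS ez; have /setD1P[ne nb2] := Xnext n (Xd _ lt).
  have nbn : X n \in nbh e S (X n.+1) by rewrite nbhE XS ?(leqW (ltnW lt)) // e_sym Xe // ltnW.
  have : [set X n; X n.+2] == nbh e S (X n.+1).
    rewrite eqEcard cards2 eq_sym ne Xd // leqnn andbT.
    by rewrite subUset !sub1set nbn nb2.
  have zn : z \in nbh e S (X n.+1) by rewrite nbhE zS.
  by move/eqP=> E; move: zn; rewrite -E => /set2P.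
have Xinj j : j <= q.+1 -> forall i, i < j -> X i != X j.
  elim/ltn_ind: j => j IHj lej i ltij.
  have dist a b : a < j -> b < j -> X a = X b -> a = b.
    move=> aj bj Xab; case: (ltngtP a b) => // lt'.
      by have := IHj b bj (leq_trans (ltnW bj) lej) a lt'; rewrite Xab eqxx.
    by have := IHj a aj (leq_trans (ltnW aj) lej) b lt'; rewrite Xab eqxx.
  case: j => // j in IHj lej ltij dist *; apply/eqP => Xij.
  have ejj : e (X i) (X j) by rewrite Xij e_sym Xe.
  case: i => [|i] in ltij Xij ejj *.
    pose Z := [set X (val m) | m : 'I_j.+1].
    have memZ m : m <= j -> X m \in Z.
      by rewrite -ltnS => lt; apply/imsetP; exists (Ordinal lt).
    have ZS : Z = S.
      apply: cS.
      - apply/subsetP => _ /imsetP[m _ ->]; apply: XS; apply: leq_trans lej.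
        exact: ltnW (ltn_ord m).
      - by apply/set0Pn; exists (X 0); apply: memZ.
      move=> _ y /imsetP[[m ltm] _ ->] /= yS; case: m => [|m] in ltm * => ey.
        have j0 : 0 < j.
          by rewrite lt0n; apply: contraTneq ejj => ->; rewrite e_irr.
        have X1j : X 1 != X j.
          apply/eqP => X1j; have j1 := dist 1 j j0 (ltnSn j) X1j.
          by have := Xback 0 (leq_trans j0 lej); rewrite Xij -j1 eqxx.
        have : [set X 1; X j] == nbh e S (X 0).
          rewrite eqEcard cards2 X1j Xd // leqnn andbT subUset !sub1set !nbhE.
          by rewrite ejj Xe // !XS // ltnW.
        move/eqP=> E; have : y \in nbh e S (X 0) by rewrite nbhE yS.
        by rewrite -E => /set2P[->|->]; apply: memZ.
      have [->|->] := Xnb m y (leq_trans ltm lej) yS ey.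
        by apply: memZ; rewrite -ltnS ltnW.
      move: ltm; rewrite ltnS leq_eqVlt => /orP[/eqP mj|lt]; last exact: memZ.
      by rewrite -[m.+2]/(m.+1.+1) mj -Xij; apply: memZ.
    have : #|Z| <= j.+1.
      by apply: leq_trans (leq_imset_card _ _) _; rewrite card_ord.
    rewrite ZS.
    by move: ltq lej; clear; lia.
  have ltiq : i < q by clear -ltij lej; lia.
  have [Xji|Xji] := Xnb i (X j) ltiq (XS _ (leq_trans (leqnSn j) lej)) ejj.
    have := dist j i (ltnSn j) (ltnW ltij) Xji.
    by move: ltij; clear; lia.
  have [lt|gt|eqij] := ltngtP i.+2 j.+1.
  - have E := dist j i.+2 (ltnSn j) lt Xji.
    by have := Xback i.+1; rewrite -E Xij eqxx => /(_ lej).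
  - have E : i.+1 = j by clear -gt ltij; lia.
    by rewrite E e_irr in ejj.
  - have E : j = i.+1 by clear -eqij; lia.
    by rewrite E e_irr in ejj.
exists (mkseq X q.+2); last by rewrite size_mkseq.
split.
- apply/mkseq_uniqP => i j; rewrite !inE => lti ltj Xij.
  case: (ltngtP i j) => // lt; first by have := Xinj j ltj i lt; rewrite Xij eqxx.
  by have := Xinj i lti j lt; rewrite Xij eqxx.
- by move=> x /mapP[i]; rewrite mem_iota => /andP[_ lti] ->; apply: XS.
- apply/(sortedP v) => i; rewrite size_mkseq => lti.
  by rewrite !nth_mkseq ?Xe // ltnW.
move=> x0 i z; rewrite size_mkseq => lti zS.
have lt1 := ltnW lti; have lt0 := ltnW lt1.
by rewrite !nth_mkseq //; apply: Xnb.
Qed.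

End Walk.
End Suspended.

(** * Extending a red path *)

Section PathExtension.
Variables (V T : finType) (r : rel T) (e : rel V).
Hypothesis r_sym : symmetric r.
Hypotheses (e_sym : symmetric e) (e_irr : irreflexive e).
Implicit Types (S : {set V}) (H : {set T}).
Local Notation blue := (blue r).
Local Notation bnb := (bnb r).

Lemma emb_replace_path S H f a b c p w :
    suspended e S [:: a, b, c & p] ->
    embeds r (contract e a c) (S :\ b) H f ->
    size w = (size p).+3 -> uniq w -> sorted r w -> {subset w <= H} ->
    head (f a) w = f a -> last (f a) w = f (last c p) ->
    {in S, forall y, y \notin [:: a, b, c & p] -> f y \notin w} ->
  emb r e S H.
Proof.
set P := [:: a, b, c & p] => -[uP sP _ intP] [fH fI fe] szw uw sw wH w0 wl wN.
have szP : size P = (size p).+3 by [].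
pose g y := if y \in P then nth (f a) w (index y P) else f y.
pose inner y := (0 < index y P) && ((index y P).+1 < size P).
have idxP y : y \in P -> index y P < size w by rewrite szw -szP index_mem.
have innerP y : inner y -> y \in P.
  by case/andP=> _ lt; rewrite -index_mem; apply: ltn_trans lt.
have inner_e y z : inner y -> z \in S -> e y z -> r (g y) (g z).
  move=> iny zS eyz; have yP := innerP y iny; have /andP[gt0 lt] := iny.
  have := intP a (index y P).-1 z; rewrite prednK // nth_index // => /(_ lt zS eyz).
  have step i : i.+1 < size P -> r (nth (f a) w i) (nth (f a) w i.+1).
    by move=> lti; have /sortedP := sw; apply; rewrite szw -szP.
  case=> E.
    have lt' : (index y P).-1 < size P.
      by apply: leq_ltn_trans (leq_pred _) (ltnW lt).
    have zP : z \in P by rewrite E mem_nth.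
    have iz : index z P = (index y P).-1 by rewrite E index_uniq.
    rewrite /g yP zP iz r_sym; have := step (index y P).-1.
    by rewrite prednK //; apply; apply: ltn_trans lt.
  have zP : z \in P by rewrite E mem_nth.
  have iz : index z P = (index y P).+1 by rewrite E index_uniq.
  by rewrite /g yP zP iz; apply: step.
have outer y : y \in S -> ~~ inner y -> g y = f y /\ y \in S :\ b.
  move=> yS; rewrite /inner /g in_setD1 yS andbT.
  case: (boolP (y \in P)) => yP ny.
    have lt := idxP y yP.
    have [i0|i0] := posnP (index y P).
      have ya : y = a by rewrite -(nth_index a yP) i0.
      rewrite i0 nth0 ya; split; first exact: w0.
      by move: uP; rewrite /P /= !inE negb_or => /andP[/andP[]].
    have il : index y P = (size p).+2.
      by apply/eqP; rewrite eqn_leq -ltnS -szw lt /= leqNgt; move: ny; rewrite i0.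
    have yl : y = last c p.
      by rewrite -(nth_index a yP) il -[(size p).+2]/((size P).-1) nth_last.
    rewrite il yl; split; first by rewrite -wl (last_nth (f a)) szw; case: (w) szw.
    move: uP; rewrite /P cons_uniq => /andP[_]; rewrite cons_uniq => /andP[bp _].
    by apply: contraNneq bp => <-; apply: mem_last.
  split=> //; apply: contraNneq yP => ->; by rewrite !inE eqxx orbT.
exists g; split=> [y yS|y z yS zS|y z yS zS eyz].
- rewrite /g; case: (boolP (y \in P)) => yP; first exact/wH/mem_nth/idxP.
  apply: fH; rewrite !inE yS andbT; apply: contraNneq yP => ->.
  by rewrite !inE eqxx orbT.
- rewrite /g; case: (boolP (y \in P)) (boolP (z \in P)) => yP [] zP.
  + move/eqP; rewrite nth_uniq ?idxP // => /eqP E.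
    by rewrite -(nth_index a yP) E nth_index.
  + by move=> E; case/negP: (wN z zS zP); rewrite -E mem_nth ?idxP.
  + by move=> E; case/negP: (wN y yS yP); rewrite E mem_nth ?idxP.
  have nb u : u \in S -> u \notin P -> u \in S :\ b.
    move=> uS uNP; rewrite !inE uS andbT; apply: contraNneq uNP => ->.
    by rewrite !inE eqxx orbT.
  by apply: fI; apply: nb.
- case: (boolP (inner y)) => iy; first exact: inner_e.
  case: (boolP (inner z)) => iz; first by rewrite r_sym inner_e // e_sym.
  have [-> yb] := outer y yS iy; have [-> zb] := outer z zS iz.
  by apply: fe; rewrite // /contract eyz.
Qed.

(* If [u] is joined to two vertices of a path whose successors are adjacent,
   the path can be rotated so as to absorb [u]. *)
Lemma reroute a1 s1 b1 s2 c1 s3 u :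
    path r a1 (s1 ++ (b1 :: s2) ++ c1 :: s3) ->
    r (last a1 s1) u -> r u (last b1 s2) -> r b1 c1 ->
  path r a1 (s1 ++ u :: rev (b1 :: s2) ++ c1 :: s3).
Proof.
rewrite cat_path /= cat_path /= => /and3P[p1 _ /and3P[p2 _ p3]] r1 r2 r3.
rewrite cat_path p1 /= r1 lastI rev_rcons /= r2 cat_path rev_path.
have -> : path (fun z => r^~ z) b1 s2.
  by rewrite (eq_path (e' := r)) // => x y; rewrite r_sym.
suff -> : last (last b1 s2) (rev (belast b1 s2)) = b1 by rewrite /= r3.
by case: s2 {p2 p3 r2} => //= x s; rewrite rev_cons last_rcons.
Qed.

Lemma path_extension k t S H f a b c p :
    ~~ books r k t H -> suspended e S [:: a, b, c & p] ->
    embeds r (contract e a c) (S :\ b) H f ->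
    (size p).+2 = 3 * (t * k) + 4 * t ->
  emb r e S H \/ ~~ bmatch r t (H :\: f @: (S :\ b)).
Proof.
move=> nbk sP fE szp; have [uP sPS oP _] := sP; have [fH fI fe] := fE.
set U := H :\: _.
have Pb x : x \in [:: a, c & p] -> x \in S :\ b.
  move: uP; rewrite /= !inE !negb_or => /and3P[/andP[ab _] /andP[bc bp] _].
  case/or3P=> [/eqP->|/eqP->|xp].
  - by rewrite ab sPS // !inE eqxx.
  - by rewrite eq_sym bc sPS // !inE eqxx !orbT.
  by rewrite sPS ?inE ?xp ?orbT // andbT; apply: contraNneq bp => <-.
pose w := map f [:: a, c & p]; pose q := (size p).+2.
have szw : size w = q by rewrite size_map.
have uw : uniq w.
  rewrite map_inj_in_uniq; last by move=> x y /Pb xS /Pb yS; apply: fI.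
  by move: uP; rewrite /= !inE !negb_or => /and3P[/and3P[_ -> ->] _ ->].
have sw : sorted r w.
  have : sorted (contract e a c) [:: a, c & p].
    rewrite /= {1}/contract !eqxx orbT /=.
    by move: oP => /= /and3P[_ _]; apply: sub_path => x y exy; rewrite /contract exy.
  move=> so; rewrite /w; apply/(sortedP (f a)) => i; rewrite size_map => lti.
  rewrite !(nth_map a) ?(ltnW lti) //; apply: fe.
  - by apply/Pb/mem_nth/ltnW.
  - exact/Pb/mem_nth.
  - by move/(sortedP a): so; apply.
have wf x : x \in w -> x \in f @: (S :\ b).
  by case/mapP=> y /Pb yS ->; apply: imset_f.
have wH x : x \in w -> x \in H by move/wf/imsetP=> [y yS ->]; apply: fH.
pose W i := nth (f a) w i.
case: (boolP [exists u in U, exists i : 'I_q, exists j : 'I_q,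
    [&& i < j, j.+1 < q, r u (W i), r u (W j) & r (W i.+1) (W j.+1)]]).
  case/existsP=> u /andP[uU /existsP[[i lti] /existsP[[j ltj]]]] /=.
  case/and5P=> ij jq ri rj rij; left.
  have /setDP[uH uf] := uU.
  have uNw : u \notin w by apply: contra uf => /wf.
  pose w1 := take i.+1 w; pose w2 := take (j - i) (drop i.+1 w).
  pose w3 := drop j.+1 w.
  have Ew : w = w1 ++ w2 ++ w3.
    rewrite /w1 /w2 /w3 -[in LHS](cat_take_drop i.+1 w); congr (_ ++ _).
    rewrite -[in LHS](cat_take_drop (j - i) (drop i.+1 w)); congr (_ ++ _).
    by rewrite drop_drop addnS subnK // ltnW.
  have sz1 : size w1 = i.+1 by rewrite size_takel // szw.
  have sz2 : size w2 = j - i by rewrite size_takel // size_drop szw -subSS leq_sub2r.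
  have sz3 : size w3 = q - j.+1 by rewrite size_drop szw.
  have ji : 0 < j - i by rewrite subn_gt0.
  have qj : 0 < q - j.+1 by rewrite subn_gt0.
  pose w' := w1 ++ u :: rev w2 ++ w3.
  have perm : perm_eq w' (u :: w).
    rewrite /w' Ew perm_catC /= perm_cons perm_catC perm_cat2l perm_cat2r.
    by rewrite perm_rev.
  have nth1 : nth (f a) w1 i = W i by rewrite /W Ew nth_cat sz1 ltnSn.
  have nth2 m : m < j - i -> nth (f a) w2 m = W (i.+1 + m).
    by move=> lt; rewrite /W Ew !nth_cat sz1 sz2 ltnNge leq_addr /= addKn lt.
  have nth3 : nth (f a) w3 0 = W j.+1 by rewrite /w3 nth_drop addn0.
  apply: (@emb_replace_path S H f a b c p w') => //.
  - by rewrite (perm_size perm) -[size (u :: w)]/(size w).+1 szw.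
  - by rewrite (perm_uniq perm) /= uNw.
  - have := sw; rewrite Ew /w'.
    case E1: w1 sz1 nth1 => [|a1 s1] //= [sz1] nth1.
    case E2: w2 sz2 nth2 => [|b1 s2] /= sz2 nth2; first by rewrite -sz2 in ji.
    case E3: w3 sz3 nth3 => [|c1 s3] /= sz3 nth3; first by rewrite -sz3 in qj.
    move=> so; apply: reroute so _ _ _.
    + by rewrite r_sym (last_nth (f a)) sz1 nth1.
    + rewrite (last_nth (f a)) nth2 -?sz2 //.
      by rewrite addSnnS sz2 subnKC // ltnW.
    + by have := nth2 0 ji; rewrite /= addn0 nth3 => ->.
  - by move=> x; rewrite (perm_mem perm) inE => /orP[/eqP->|/wH].
  - rewrite /w' last_cat /= last_cat.
    have : last (f a) w = f (last c p) by rewrite /w /= last_map.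
    rewrite Ew !last_cat; case: (w3) sz3 => [|c1 s3] //= sz3.
    by rewrite -sz3 in qj.
  move=> y yS yP; rewrite (perm_mem perm) inE negb_or.
  have yb : y \in S :\ b.
    by rewrite !inE yS andbT; apply: contraNneq yP => ->; rewrite !inE eqxx orbT.
  apply/andP; split; first by apply: contraNneq uf => <-; apply: imset_f.
  apply/mapP => -[z zP fyz]; case/negP: yP.
  have -> : y = z := fI _ _ yb (Pb z zP) fyz.
  by move: zP; rewrite !inE => /or3P[] ->; rewrite ?orbT.
move=> no; right; apply: contra nbk => bm.
have t0 : 0 < t by case: t szp {bm}.
pose Q := [set x in take q.-1 w].
have cQ : #|Q| = q.-1.
  rewrite cardsE (card_uniqP _) ?take_uniq // size_takel // szw.
  exact: leq_pred.
have Qw x : x \in Q -> (x \in w) && (index x w < q.-1).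
  by rewrite inE => xt; rewrite (mem_take xt) (index_ltn xt).
pose next x := W (index x w).+1.
have red u : u \in U -> #|[set x in Q | ~~ blue u x]| <= (t * (k + 2)).-1 \/ books r k t H.
  move=> uU; have /setDP[uH uf] := uU; set R := [set x in Q | _].
  have RP x : x \in R -> [/\ x \in w, (index x w).+1 < q & r u x].
    rewrite inE => /andP[/Qw/andP[xw lt] nb]; split=> //.
    by apply: blueN nb; apply: contraNneq uf => ->; apply: wf.
  have Wnext x y : x \in R -> y \in R -> index x w < index y w ->
      blue (next x) (next y).
    move=> /RP[xw ltx rx] /RP[yw lty ry] lt; rewrite /blue /next.
    rewrite nth_uniq ?szw // eqSS neq_ltn lt /=.
    move: no; apply: contra => rr; apply/existsP; exists u; rewrite uU /=.
    apply/existsP; exists (Ordinal (ltnW ltx)); apply/existsP.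
    exists (Ordinal (ltnW lty)) => /=.
    by rewrite lt lty /W !nth_index // rx ry.
  have blue_next x y : x \in R -> y \in R -> x != y -> blue (next x) (next y).
    move=> xR yR xy; case: (ltngtP (index x w) (index y w)) => [lt|lt|E].
    - exact: Wnext.
    - by rewrite blue_sym //; apply: Wnext.
    have [xw _ _] := RP x xR; have [yw _ _] := RP y yR.
    by move: xy; rewrite -(nth_index (f a) xw) E nth_index ?eqxx.
  have nI : {in R &, injective next}.
    move=> x y xR yR E; apply/eqP/negPn/negP => xy.
    by have := blue_next x y xR yR xy; rewrite E blueF.
  have [le|lt] := leqP #|R| (t * (k + 2)).-1; [by left|right].
  apply: (@booksS _ _ _ _ (next @: R)).
    by apply/subsetP => _ /imsetP[x /RP[_ lt' _] ->]; apply/wH/mem_nth; rewrite szw.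
  apply: blue_clique_books; last by rewrite card_in_imset // (leq_trans (leqSpred _)).
  move=> _ _ /imsetP[x xR ->] /imsetP[y yR ->] ne; apply: blue_next => //.
  by apply: contraNneq ne => ->.
apply/negPn/negP => nbk; case/negP: (nbk).
have : books r k t (U :|: Q).
  apply: (bmatch_books (c := (t * (k + 2)).-1)) => //.
  - rewrite -setI_eq0; apply/eqP/setP => x; rewrite in_setI in_set0.
    by apply/negP => /andP[/setDP[_ /negP xf] /Qw/andP[/wf]].
  - by move=> u /red[] //; rewrite (negbTE nbk).
  - rewrite cQ /q szp; nia.
apply: booksS; rewrite subUset subsetDl /=.
by apply/subsetP => x /Qw/andP[/wH].
Qed.

End PathExtension.

Section NoBook.
Variables (V T : finType) (r : rel T).
Hypothesis r_sym : symmetric r.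
Implicit Types (e : rel V) (S : {set V}) (H W : {set T}).

Lemma contract_suspended e l S a b c p : symmetric e -> irreflexive e ->
    conn e S -> sparse e l S -> suspended e S [:: a, b, c & p] ->
  [/\ symmetric (contract e a c), irreflexive (contract e a c),
      conn (contract e a c) (S :\ b), sparse (contract e a c) l (S :\ b)
    & b \in S].
Proof.
move=> e_sym e_irr cS spS [uP sP oP intP].
have [aS bS] : a \in S /\ b \in S by split; apply: sP; rewrite !inE eqxx ?orbT.
have /and3P[eab ebc _] := oP.
move: uP; rewrite /= !inE !negb_or => /and3P[/and3P[ab ac _] _ _].
split=> //.
- exact: contract_sym.
- exact: contract_irr.
- apply: conn_contract => // z zS ez.
  by have := intP a 0 z isT zS ez.
- exact: sparse_contract.
Qed.

Lemma nobook_books1 k H : nobook r k H -> ~~ books r k 1 H.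
Proof. by move=> nb; apply/existsPn => D; apply/and3P => -[/(nobookP nb)]. Qed.

Lemma nobook_emb k e l S W : symmetric e -> irreflexive e -> 0 < k ->
    nobook r k W -> conn e S -> sparse e l S -> 2 * #|S| + 2 * k <= #|W| ->
    60 * (k * l) + 60 * l + 13 * k + 15 <= #|W| ->
  emb r e S W.
Proof.
move=> + + k0 nbW; have [n] := ubnP #|S|.
elim: n S e => // n IHn S e ltS e_sym e_irr cS spS leW bigW.
have [crude|big] := leqP (3 * #|S| + 4 * k + 6 * (k * l)) #|W|.
  exact: (crude_emb r_sym e_sym e_irr k0 nbW spS).
have S_gt1 : 1 < #|S| by lia.
case: (set_0Vmem (leaves e S)) => [L0|[v vL]].
  have [||P sP szP] := exists_suspended e_sym e_irr cS spS S_gt1 (q := 3 * k + 3).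
  - by rewrite L0 cards0; nia.
  - by lia.
  case: P sP szP => [|a [|b [|c p]]] sP /= szP; try (clear -szP; lia).
  have [e'_sym e'_irr cS' spS' bS] := contract_suspended e_sym e_irr cS spS sP.
  have cb := cardsD1 b S; rewrite bS in cb.
  have [||f fE] := IHn (S :\ b) _ _ e'_sym e'_irr cS' spS' _ bigW.
  - by move: ltS cb; clear; lia.
  - by move: leW cb; clear; lia.
  have szp : (size p).+2 = 3 * (1 * k) + 4 * 1 by clear -szP; lia.
  have [//|nbU] := path_extension r_sym e_sym (nobook_books1 nbW) sP fE szp.
  set U := W :\: _ in nbU.
  have cU : #|W| <= #|U| + #|S|.-1.
    have := card_setD_ge W (f @: (S :\ b)); have := leq_imset_card f (S :\ b).
    by rewrite -/U; clear -cb; lia.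
  apply: embS (subsetDl W (f @: (S :\ b))) _.
  apply: (near_clique_emb r_sym e_sym e_irr spS (d := 0)).
  - move=> x xU; rewrite leqn0 cards_eq0; apply/eqP/setP => y.
    rewrite inE in_set0; apply/negP => /andP[yU xy].
    case/negP: nbU; apply/existsP; exists x; apply/existsP; exists y.
    by rewrite xU xy yU.
  - by rewrite -/U; clear -cU leW S_gt1; lia.
  - by rewrite -/U; clear -cU bigW leW; lia.
have [vS /cards1P[p nbv]] : v \in S /\ #|nbh e S v| == 1.
  by move: vL; rewrite inE => /andP.
have /andP[pS evp] : (p \in S) && e v p by rewrite -nbhE nbv set11.
have pv : p != v by apply: contraTneq evp => ->; rewrite e_irr.
have cv := cardsD1 v S; rewrite vS in cv.
have [||||f fE] := IHn (S :\ v) e _ e_sym e_irr _ _ _ bigW.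
- by move: ltS cv; clear; lia.
- by apply: conn_remove_leaves => //; rewrite sub1set.
- by apply: sparseS spS; apply: subsetDl.
- by move: leW cv; clear; lia.
have [fW _ _] := fE.
have fp : f p \in W by apply: fW; rewrite !inE pv.
set U := W :\: f @: (S :\ v).
have cU : #|W| <= #|U| + #|S|.-1.
  have := card_setD_ge W (f @: (S :\ v)); have := leq_imset_card f (S :\ v).
  by rewrite -/U; clear -cv; lia.
case: (boolP [exists u in U, r (f p) u]) => [/existsP[u /andP[/setDP[uW uf] ru]]|].
  exists [eta f with v |-> u]; apply: embeds_extend => // y /setD1P[_ yS] evy.
  have : y \in nbh e S v by rewrite nbhE yS.
  by rewrite nbv => /set1P->; rewrite r_sym.
move=> /existsPn nor; apply: embS (subsetDl W (f @: (S :\ v))) _.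
apply: (near_clique_emb r_sym e_sym e_irr spS (d := k.-1)).
- apply: (@blue_leS _ _ _ _ (bnb r W (f p))); last exact: nobook_blue_le.
  apply/subsetP => u uU; have /setDP[uW uf] := uU; rewrite inE uW /blue.
  have := nor u; rewrite uU /= => ->; rewrite andbT.
  by apply: contraNneq uf => <-; apply: imset_f; rewrite !inE pv.
- by rewrite -/U; clear -cU leW k0 S_gt1; lia.
- by rewrite prednK // -/U; clear -cU leW bigW k0 S_gt1; nia.
Qed.

End NoBook.

(** * Leaves *)

Lemma hall_marriage (V T : finType) (z : T) (N : V -> {set T}) (L : {set V}) :
    (forall J : {set V}, J \subset L -> #|J| <= #|\bigcup_(j in J) N j|) ->
  exists2 h : V -> T, {in L, forall l, h l \in N l} & {in L &, injective h}.
Proof.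
have [n] := ubnP #|L|; elim: n L N => // n IHn L N ltL hall.
have [L0|[l lL]] := set_0Vmem L.
  by exists (fun=> z) => [l|l m]; rewrite L0 inE.
have cupD (M : {set V}) Z :
    \bigcup_(j in M) (N j :\: Z) = (\bigcup_(j in M) N j) :\: Z.
  apply/setP => x; rewrite inE; apply/bigcupP/andP.
    by case=> j jM /setDP[xN xZ]; split=> //; apply/bigcupP; exists j.
  by case=> xZ /bigcupP[j jM xN]; exists j => //; rewrite inE xZ.
case: (boolP [exists J : {set V},
    [&& J \proper L, J != set0 & #|\bigcup_(j in J) N j| <= #|J|]]).
  case/existsP => J /and3P[pJ J0 crit]; have sJ := proper_sub pJ.
  have cL : #|L| = #|J| + #|L :\: J| by rewrite -(cardsID J L) (setIidPr sJ).
  have cJ : 0 < #|J| by rewrite card_gt0.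
  have [||h1 h1N h1I] := IHn J N; first by have := proper_card pJ; clear -ltL; lia.
    by move=> K sK; apply: hall; apply: subset_trans sJ.
  pose Z := \bigcup_(j in J) N j.
  have [||h2 h2N h2I] := IHn (L :\: J) (fun j => N j :\: Z).
  - by clear -ltL cL cJ; lia.
  - move=> K sK; rewrite cupD.
    have dKJ : K :&: J = set0.
      apply/eqP; rewrite setI_eq0; apply: disjointWl sK _.
      by rewrite -setI_eq0 setIC setIDA setIC -setIDA setDv setI0.
    have sKJ : K :|: J \subset L.
      by rewrite subUset sJ (subset_trans sK) ?subsetDl.
    have := hall _ sKJ; rewrite bigcup_setU -/Z cardsU dKJ cards0 subn0.
    have -> : (\bigcup_(j in K) N j) :|: Z = Z :|: ((\bigcup_(j in K) N j) :\: Z).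
      by apply/setP => x; rewrite !inE; case: (x \in Z); rewrite /= ?orbT ?orbF.
    have := (leq_card_setU Z ((\bigcup_(j in K) N j) :\: Z)).1.
    by move: crit; rewrite -/Z; clear; lia.
  exists (fun x => if x \in J then h1 x else h2 x) => [x xL|x y xL yL].
    case: ifP => xJ; first exact: h1N.
    by have /setDP[] : h2 x \in N x :\: Z by apply: h2N; rewrite inE xJ.
  have h1Z u : u \in J -> h1 u \in Z.
    by move=> uJ; apply/bigcupP; exists u => //; apply: h1N.
  have h2Z u : u \in L -> u \in J = false -> h2 u \notin Z.
    move=> uL uJ; have /setDP[] : h2 u \in N u :\: Z; last by [].
    by apply: h2N; rewrite inE uJ.
  case: ifP => xJ; case: ifP => yJ; first exact: h1I.
  - by move=> E; have := h2Z y yL yJ; rewrite -E h1Z.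
  - by move=> E; have := h2Z x xL xJ; rewrite E h1Z.
  - by apply: h2I; rewrite inE ?xJ ?yJ.
move/existsPn => slack.
have /card_gt0P[u] : 0 < #|N l|.
  by have := hall [set l]; rewrite sub1set big_set1 cards1; apply.
move=> uN; have cl := cardsD1 l L; rewrite lL in cl.
have [||h hN hI] := IHn (L :\ l) (fun j => N j :\: [set u]).
- by clear -ltL cl; lia.
- move=> K sK; rewrite cupD.
  have [->|K0] := eqVneq K set0; first by rewrite cards0.
  have pK : K \proper L.
    apply/properP; split; first by apply: subset_trans sK (subsetDl _ _).
    by exists l => //; apply/negP => /(subsetP sK); rewrite !inE eqxx.
  have := slack K; rewrite pK K0 /= -ltnNge.
  have := card_setD_ge (\bigcup_(j in K) N j) [set u]; rewrite cards1.
  by clear; lia.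
have hu x : x \in L :\ l -> h x != u.
  by move=> /hN; rewrite !inE => /andP[].
have hL x : x \in L -> x != l -> x \in L :\ l by move=> xL xl; rewrite !inE xl.
exists (fun x => if x == l then u else h x) => [x xL|x y xL yL].
  case: eqP => [->|/eqP xl] //.
  by have /setDP[] := hN x (hL x xL xl).
case: eqP => [->|/eqP xl]; case: eqP => [->|/eqP yl] //.
- by move=> E; have := hu y (hL y yL yl); rewrite -E eqxx.
- by move=> E; have := hu x (hL x xL xl); rewrite E eqxx.
- by apply: hI; apply: hL.
Qed.

(** * Two near cliques *)

Section TwoCliques.
Variables (T : finType) (r : rel T) (k t n c : nat).
Hypothesis r_sym : symmetric r.
Implicit Types (K X Z R : {set T}).
Local Notation blue := (blue r).
Local Notation bnb := (bnb r).
Hypotheses (k_gt0 : 0 < k) (nbk : ~~ books r k t setT).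

Definition clique_pair K K' :=
  [/\ blue_le r k.-1 K, blue_le r k.-1 K', #|K :&: K'| <= k.-1,
      n <= #|K| + c /\ n <= #|K'| + c
    & {in K :|: K', forall v, #|T| < #|bnb setT v| + n}].

Lemma clique_pairC K K' : clique_pair K K' -> clique_pair K' K.
Proof. by case=> ? ? ? [? ?] ?; split; rewrite 1?setIC 1?setUC. Qed.

Lemma card_outside K K' :
  #|~: (K :|: K')| + #|K| + #|K'| = #|T| + #|K :&: K'|.
Proof. by have := cardsC (K :|: K'); have := cardsUI K K'; clear; lia. Qed.

Lemma clique_pair_miss K K' x : clique_pair K K' -> x \in K ->
  #|K' :\: bnb setT x| <= c + 2 * k.
Proof.
case=> bK _ cI [cK _] deg xK.
have sub : bnb setT x \subset (K' :&: bnb setT x) :|: (bnb K x :|: ~: (K :|: K')).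
  apply/subsetP => y; rewrite !inE /= => xy; rewrite xy.
  by case: (y \in K); case: (y \in K').
have := leq_trans (subset_leq_card sub) (leq_card_setU _ _).1.
have := (leq_card_setU (bnb K x) (~: (K :|: K'))).1.
have := card_outside K K'; have := cardsID (bnb setT x) K'.
have := bK x xK; have := deg x; rewrite inE xK => /(_ isT).
by move: cI cK; clear; lia.
Qed.

Hypothesis n_big : 3 * c + 5 * k + t * k <= n.

Lemma clique_pair_no_bmatch K K' : clique_pair K K' -> ~~ bmatch r t K.
Proof.
move=> P; apply: contra nbk => bm.
apply: booksS (subsetT (K :|: (K' :\: K))) _.
apply: (bmatch_books (c := c + 2 * k)) => //.
- by rewrite -setI_eq0; apply/eqP/setP => y; rewrite !inE; case: (y \in K).
- move=> u uK; apply: leq_trans (clique_pair_miss P uK).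
  apply/subset_leq_card/subsetP => y; rewrite !inE => /andP[/andP[_ ->] nb].
  by rewrite (negbTE nb).
have [_ _ cI [_ cK'] _] := P.
by have := cardsID K K'; move: cI cK' n_big; rewrite setIC; clear; lia.
Qed.

Let h := c + 2 * k + t * (k + 2).

Lemma many_connectors_books j K K' Z R : j <= t -> clique_pair K K' ->
    R \subset ~: (K :|: K') -> [disjoint R & Z] -> j <= #|R| ->
    {in R, forall z, h <= #|bnb K z| /\ h <= #|bnb K' z|} ->
    #|Z| <= (t - j) * (k + 2) -> books r k j (~: Z).
Proof.
move=> + P; elim: j Z R => // j IHj Z R lejt sR dRZ ltR hR leZ.
have /card_gt0P[z zR] : 0 < #|R| := leq_trans (ltn0Sn j) ltR.
have [hK hK'] := hR z zR.
have zout : z \notin K :|: K' by have := subsetP sR z zR; rewrite inE.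
have leZ' : #|Z| + (k + 2) <= t * (k + 2).
  have : (t - j.+1) * (k + 2) + (k + 2) = (t - j) * (k + 2).
    by rewrite -mulSnr subnSK.
  have : (t - j) * (k + 2) <= t * (k + 2) by rewrite leq_mul2r leq_subr orbT.
  by move: leZ; clear; lia.
have [v vB vZ] : exists2 v, v \in bnb K z & v \notin Z.
  by apply: exists_notin; move: hK leZ'; rewrite /h; clear; lia.
have [vK zv] : v \in K /\ blue z v by move: vB; rewrite inE => /andP.
have miss := clique_pair_miss P vK.
have [D sD cD] : exists2 D : {set T},
    D \subset bnb K' z :\: (K' :\: bnb setT v) :\: Z & #|D| = k.
  apply: exists_subset_card.
  have := card_setD_ge (bnb K' z) (K' :\: bnb setT v).
  have := card_setD_ge (bnb K' z :\: (K' :\: bnb setT v)) Z.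
  by move: hK' miss leZ'; rewrite /h; clear; lia.
have DP y : y \in D -> [/\ y \in K', blue z y, blue v y & y \notin Z].
  move/(subsetP sD); rewrite !inE => /and3P[-> nb /andP[yK' ->]].
  by move: nb; rewrite yK' andbT negbK /= => ->.
have zZ : z \notin Z by rewrite (disjointFr dRZ).
pose E := z |: (v |: D).
have bE : isbook r k E.
  by apply/isbookP; exists z, v, D; split=> // y /DP[].
apply: (books_cons (D := E)) => //.
  rewrite !subUset !sub1set !inE zZ vZ /=.
  by apply/subsetP => y /DP[_ _ _]; rewrite inE.
rewrite setDE -setCU; apply: (IHj (Z :|: E) (R :\ z)).
- exact: ltnW.
- by apply: subset_trans (subsetDl _ _) sR.
- rewrite -setI_eq0; apply/eqP/setP => y; rewrite in_set0; apply/negP.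
  rewrite in_setI in_setU in_setD1 => /andP[/andP[yz yR]].
  have yout : y \notin K :|: K' by have := subsetP sR y yR; rewrite inE.
  rewrite (disjointFr dRZ yR) /= !in_setU1 (negbTE yz) /=.
  move: yout; rewrite in_setU negb_or => /andP[yK yK'].
  by case/orP=> [/eqP E1|/DP[E1 _ _ _]]; [move: yK; rewrite E1 vK | move: yK'; rewrite E1].
- by move: ltR; rewrite (cardsD1 z R) zR.
- by move=> y /setD1P[_ /hR].
apply: leq_trans (leq_card_setU _ _) _; rewrite (isbook_card bE) // -(subnSK lejt).
by rewrite mulSnr leq_add2r.
Qed.

Hypothesis T_le : 2 * (t * k) + (#|T| + 2 * c + k - 2 * n) * h + c < n.

Lemma outside_le K K' : clique_pair K K' ->
  #|~: (K :|: K')| <= #|T| + 2 * c + k - 2 * n.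
Proof.
by case=> _ _ cI [cK cK'] _; have := card_outside K K'; move: cI cK cK'; clear; lia.
Qed.

(* Some vertex of [K] is blue-isolated in [absorb K K'], which must therefore
   be smaller than [n]. *)
Definition absorb K K' :=
  K :|: [set z in ~: (K :|: K') | #|bnb K z| < h].

Lemma absorb_lt K K' : clique_pair K K' -> #|absorb K K'| < n.
Proof.
move=> P; have [bK _ _ [cK _] deg] := P.
have [m ltm /andP[bm nbm]] := bmatch_max (clique_pair_no_bmatch P).
have [X [_ [sX _ cX _ [_ rX _]]]] := bmatch_structure bm nbm.
pose R1 := [set z in ~: (K :|: K') | #|bnb K z| < h].
pose Bad := (\bigcup_(y in K :\: X) bnb K y) :|: (\bigcup_(z in R1) bnb K z).
have cKX : #|K :\: X| = 2 * m.
  by have := cardsID X K; rewrite (setIidPr sX) cX; clear; lia.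
have cB1 : #|\bigcup_(y in K :\: X) bnb K y| <= (2 * m) * k.-1.
  by rewrite -cKX; apply: card_bigcup_le => y /setDP[/bK].
have cB2 : #|\bigcup_(z in R1) bnb K z| <= (#|T| + 2 * c + k - 2 * n) * h.
  apply: (@leq_trans (#|R1| * h)).
    by apply: card_bigcup_le => z; rewrite !inE => /andP[_ /ltnW].
  rewrite leq_mul2r; apply/orP; right; apply: leq_trans (outside_le P).
  by apply/subset_leq_card/subsetP => z; rewrite inE => /andP[].
have [v vX vBad] : exists2 v, v \in X & v \notin Bad.
  apply: exists_notin; apply: leq_ltn_trans (leq_card_setU _ _) _.
  have mk : 2 * m * k.-1 + 2 * m <= 2 * (t * k).
    by rewrite -mulnSr prednK // -mulnA leq_mul2l leq_mul2r (ltnW ltm) orbT.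
  by move: cB1 cB2 T_le cX cK mk; clear; lia.
have vK : v \in K := subsetP sX v vX.
have noblue y : y \in absorb K K' -> ~~ blue v y.
  move: vBad; rewrite in_setU negb_or => /andP[v1 v2].
  rewrite /absorb -/R1 in_setU => /orP[yK|yR].
    case: (boolP (y \in X)) => yX; first exact: rX.
    apply: contra v1 => vy; apply/bigcupP; exists y; first by rewrite inE yX.
    by rewrite inE vK blue_sym.
  apply: contra v2 => vy; apply/bigcupP; exists y => //.
  by rewrite inE vK blue_sym.
have : bnb setT v \subset ~: absorb K K'.
  apply/subsetP => y; rewrite inE in_setC => /andP[_ vy].
  by apply: contraL vy => /noblue.
move/subset_leq_card; have := cardsC (absorb K K').
by have := deg v; rewrite inE vK => /(_ isT); clear; lia.
Qed.

Lemma clique_pair_contra K K' : clique_pair K K' -> #|T| + 2 < 2 * n + t.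
Proof.
move=> P; have P' := clique_pairC P.
pose R := [set z in ~: (K :|: K') | (h <= #|bnb K z|) && (h <= #|bnb K' z|)].
have ltR : #|R| < t.
  rewrite ltnNge; apply: contra nbk => leR; rewrite -(setC0 T).
  apply: (many_connectors_books (leqnn t) P (R := R)) => //.
  - by apply/subsetP => z; rewrite inE => /andP[].
  - by rewrite -setI_eq0 setI0.
  - by move=> z; rewrite inE => /and3P[].
  - by rewrite cards0.
have : setT \subset absorb K K' :|: (absorb K' K :|: R).
  apply/subsetP => z _; rewrite /absorb /R !inE.
  case: (z \in K); case: (z \in K') => //=.
  by rewrite ltnNge; case: (h <= #|bnb K z|); rewrite ?orbT //= ltnNge; case: (h <= _).
move/subset_leq_card; rewrite cardsT.
have := (leq_card_setU (absorb K K') (absorb K' K :|: R)).1.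
have := (leq_card_setU (absorb K' K) R).1.
by have := absorb_lt P; have := absorb_lt P'; move: ltR; clear; lia.
Qed.

End TwoCliques.

(** * The exact upper bound *)

Section Goodness.
Variables (V T : finType) (r : rel T).
Hypothesis r_sym : symmetric r.
Implicit Types (e : rel V) (S L : {set V}) (H W K : {set T}) (f : V -> T).
Local Notation blue := (blue r).
Local Notation bnb := (bnb r).

Lemma embeds_attach e S L H f h : symmetric e -> L \subset S ->
    embeds r e (S :\: L) H f ->
    {in L, forall x, h x \in H :\: f @: (S :\: L)} -> {in L &, injective h} ->
    {in L & S, forall x y, e x y -> y \notin L /\ r (h x) (f y)} ->
  embeds r e S H (fun x => if x \in L then h x else f x).
Proof.
move=> e_sym sLS [fH fI fe] hH hI he.
have inD x : x \in S -> x \notin L -> x \in S :\: L by move=> xS xL; rewrite inE xL.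
have hNf x y : x \in L -> y \in S -> y \notin L -> h x <> f y.
  move=> xL yS yL E; have /setDP[_] := hH x xL; rewrite E; case/negP.
  by apply: imset_f; apply: inD.
split=> [x xS|x y xS yS|x y xS yS exy].
- case: ifP => xL; first by have /setDP[] := hH x xL.
  by apply: fH; rewrite inD ?xL.
- case: (boolP (x \in L)) (boolP (y \in L)) => xL [] yL.
  + exact: hI.
  + by move/(hNf x y xL yS yL).
  + by move/esym/(hNf y x yL xS xL).
  + by apply: fI; apply: inD.
case: (boolP (x \in L)) => xL.
  by have [/negbTE-> ?] := he x y xL yS exy.
case: (boolP (y \in L)) => yL; last by apply: fe exy; apply: inD.
by have [_] := he y x yL xS ltac:(by rewrite e_sym); rewrite r_sym.
Qed.

Section Star.
Variables (k t l : nat) (e : rel V) (S : {set V}) (W : {set T}).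
Hypotheses (e_sym : symmetric e) (e_irr : irreflexive e).
Hypotheses (k_gt0 : 0 < k) (nbk : ~~ books r k t setT) (nbW : nobook r k W)
  (cW : #|~: W| <= t.-1 * (k + 2)) (spS : sparse e l S).

Let c := t.-1 * (k + 1).

Variables (p : V) (L : {set V}).
Hypotheses (pS : p \in S) (sLS : L \subset S) (pL : p \notin L)
  (nbL : {in L, forall x, nbh e S x = [set p]}) (cL : c + 2 * k <= #|L|).
Hypotheses (leS : k * (2 * l + 2) + c < #|S|).

(* [S :\: L] uses at most [#|S| - #|L|] vertices of the complement of
   [bnb setT v], which leaves room for the leaves of [p] around [v]. *)
Lemma center_emb K v : blue_le r k.-1 K -> #|S| <= #|K| + c -> v \in K ->
  #|bnb setT v| + #|S| <= #|T| -> emb r e S setT.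
Proof.
move=> bK cK vK dv.
have cSL : #|S| = #|L| + #|S :\: L| by rewrite -(cardsID L S) (setIidPr sLS).
have [|||f fE fp] := near_clique_embedding r_sym e_sym e_irr
    (sparseS (subsetDl S L) spS) (p := p) _ vK bK.
- by rewrite inE pL.
- by move: cSL cK cL; clear -k_gt0; lia.
- by rewrite prednK //; move: leS cK; clear; lia.
pose A := ~: bnb setT v :\: f @: (S :\: L).
have cA : #|L| <= #|A|.
  have := card_setD_ge (~: bnb setT v) (f @: (S :\: L)); rewrite -/A.
  have := leq_imset_card f (S :\: L); have := cardsC (bnb setT v).
  by move: cSL dv; clear; lia.
have [h hA hI] := exists_injection v cA.
exists (fun x => if x \in L then h x else f x).
apply: embeds_attach => //; first exact: embedsS (subsetT K) fE.
  by move=> x /hA /setDP[_ hf]; rewrite in_setD hf in_setT.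
move=> x y xL yS exy; have : y \in nbh e S x by rewrite nbhE yS.
rewrite nbL // => /set1P->; split=> //.
rewrite fp; have /setDP[hb hf] := hA x xL; apply: blueN.
  by apply: contraNneq hf => ->; rewrite -fp imset_f // inE pL.
by move: hb; rewrite !inE /= blue_sym.
Qed.

Lemma star_emb K : K \subset W -> blue_le r k.-1 K -> #|S| <= #|K| + c ->
    2 * #|S| + t <= #|T| + 2 -> 3 * c + 5 * k + t * k <= #|S| ->
    2 * (t * k) + (#|T| + 2 * c + k - 2 * #|S|) * (c + 2 * k + t * (k + 2)) + c
      < #|S| ->
  emb r e S setT.
Proof.
move=> sKW bK cK leT big1 big2.
case: (boolP [exists v in K, #|bnb setT v| + #|S| <= #|T|]).
  by case/existsP=> v /andP[vK dv]; apply: (center_emb bK cK vK dv).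
move=> /existsPn hiK.
have degK v : v \in K -> #|T| < #|bnb setT v| + #|S|.
  by move=> vK; have := hiK v; rewrite vK /= ltnNge.
have /card_gt0P[v vK] : 0 < #|K| by move: cK leS; clear; lia.
have vW : v \in W := subsetP sKW v vK.
pose K' := bnb W v.
have bK' : blue_le r k.-1 K' by apply: nobook_blue_le.
have t_gt0 : 0 < t by move: nbk; case: (t).
have cK' : #|S| <= #|K'| + c.
  have : #|bnb setT v| <= #|K'| + #|~: W|.
    apply: leq_trans (leq_card_setU _ _).1; apply/subset_leq_card/subsetP => y.
    by rewrite !inE /= => ->; case: (y \in W).
  have := degK v vK; have -> : c = t.-1 * (k + 2) - t.-1.
    by rewrite /c !mulnDr muln1 muln2 -addnn addnA addnK.
  have : t.-1 <= t.-1 * (k + 2) by rewrite leq_pmulr // addn2.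
  by move: cW leT t_gt0; clear; lia.
case: (boolP [exists v in K', #|bnb setT v| + #|S| <= #|T|]).
  by case/existsP=> v' /andP[vK' dv]; apply: (center_emb bK' cK' vK' dv).
move=> /existsPn hiK'.
have degK' u : u \in K' -> #|T| < #|bnb setT u| + #|S|.
  by move=> uK; have := hiK' u; rewrite uK /= ltnNge.
have P : clique_pair r k #|S| c K K'.
  split=> //.
    apply: leq_trans (bK v vK); apply/subset_leq_card/subsetP => y.
    by rewrite !inE => /and3P[-> _ ->].
  by move=> u; rewrite inE => /orP[/degK|/degK'].
have := clique_pair_contra r_sym k_gt0 nbk big1 big2 P.
by move: leT; clear; lia.
Qed.

End Star.
End Goodness.

Section Main.
Variables (V T : finType) (r : rel T).
Hypothesis r_sym : symmetric r.
Variables (k t l : nat).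
Hypotheses (k_gt0 : 0 < k) (nbk : ~~ books r k t setT).
Implicit Types (e : rel V) (S L : {set V}) (H W K : {set T}) (f : V -> T).
Local Notation blue := (blue r).
Local Notation bnb := (bnb r).

Let c := t.-1 * (k + 1).

(* The lower bounds on the number [m] of guest vertices used in the exact
   embedding. *)
Definition large m :=
  [/\ forall s, s < t * k * (c + 2 * k) ->
        2 * l + 2 * s + (3 * (t * k) + 4 * t).-1 * (6 * l + 4 * s) < m,
      3 * (t * k) + 4 * t < m, 2 * l + 9 * t <= m
    & [/\ k * (2 * l + 2) + c < m, 3 * c + 5 * k + t * k <= m
      & 2 * (t * k) + (3 * k + 2 * c + t.-1 * (k + 2))
                      * (c + 2 * k + t * (k + 2)) + c < m]].

Lemma leaf_parent e S : symmetric e -> conn e S -> 2 < #|S| ->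
  exists par : V -> V, {in leaves e S, forall x,
    [/\ nbh e S x = [set par x], par x \in S & par x \notin leaves e S]}.
Proof.
move=> e_sym cS S_gt2.
exists (fun x => odflt x [pick y in nbh e S x]) => x.
rewrite inE => /andP[xS /cards1P[y nbx]].
have -> : odflt x [pick y in nbh e S x] = y.
  case: pickP => [z|/(_ y)]; first by rewrite nbx => /set1P.
  by rewrite nbx set11.
have /andP[yS exy] : (y \in S) && e x y by rewrite -nbhE nbx set11.
split=> //; rewrite inE yS /=; apply: contraTN S_gt2 => /cards1P[z nby].
have zx : z = x.
  have : x \in nbh e S y by rewrite nbhE xS e_sym.
  by rewrite nby => /set1P.
rewrite -leqNgt; have <- : [set x; y] = S.
  apply: cS; first by rewrite subUset !sub1set xS.
    by apply/set0Pn; exists x; rewrite set21.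
  move=> u w /set2P[->|->] wS euw.
    have : w \in nbh e S x by rewrite nbhE wS.
    by rewrite nbx => /set1P->; rewrite set22.
  have : w \in nbh e S y by rewrite nbhE wS.
  by rewrite nby zx => /set1P->; rewrite set21.
by rewrite cards2; case: (x != y).
Qed.

Lemma sparse_conn_emb e S : symmetric e -> irreflexive e ->
    conn e S -> sparse e l S -> 2 * #|S| + t <= #|T| + 2 ->
    (forall m, #|T| < 2 * m + 2 * k + t.-1 * (k + 2) -> large m) ->
    60 * (k * l) + 60 * l + 13 * k + 15 + t.-1 * (k + 2) <= #|T| ->
  emb r e S setT.
Proof.
have [W [cW nbW]] : exists W, #|~: W| <= t.-1 * (k + 2) /\ nobook r k W.
  have [F [_ cF nbF]] := max_books nbk; exists (~: F).
  by rewrite setCK; split=> //; move: nbF; rewrite setTD.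
have cWT := cardsC W.
have [n] := ubnP #|S|; elim: n S e => // n IHn S e ltS e_sym e_irr cS spS leT lrg bigT.
have [leW|ltT] := leqP (2 * #|S| + 2 * k + t.-1 * (k + 2)) #|T|.
  apply: embS (subsetT W) _.
  apply: (nobook_emb r_sym e_sym e_irr k_gt0 nbW cS spS).
    by move: leW cW cWT; clear; lia.
  by move: bigT cW cWT; clear; lia.
have [n1 n2 n3 [n4 n5 n6]] := lrg _ ltT.
have t_gt0 : 0 < t by move: nbk; case: (t).
have S_gt2 : 2 < #|S| by move: n2 t_gt0; clear; lia.
have [few|many] := ltnP #|leaves e S| (t * k * (c + 2 * k)).
  have [||P sP szP] := exists_suspended e_sym e_irr cS spS (ltnW S_gt2)
    (q := (3 * (t * k) + 4 * t).-1); first exact: n1.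
    by rewrite prednK //; move: t_gt0; clear; lia.
  case: P sP szP => [|a [|b [|d p]]] sP /= szP;
    try by move: szP t_gt0; clear; lia.
  have [e'_sym e'_irr cS' spS' bS] := contract_suspended e_sym e_irr cS spS sP.
  have cb := cardsD1 b S; rewrite bS in cb.
  have [||f fE] := IHn (S :\ b) _ _ e'_sym e'_irr cS' spS' _ lrg bigT.
  - by move: ltS cb; clear; lia.
  - by move: leT cb; clear; lia.
  have szp : (size p).+2 = 3 * (t * k) + 4 * t.
    by move: szP t_gt0; clear; lia.
  have [//|nbU] := path_extension r_sym e_sym nbk sP fE szp.
  apply: embS (subsetT _) _.
  apply: (near_complete_emb r_sym e_sym e_irr spS nbU) => //.
  have := card_setD_ge setT (f @: (S :\ b)); have := leq_imset_card f (S :\ b).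
  by rewrite cardsT; move: cb leT t_gt0; clear; lia.
set L := leaves e S in many.
have sLS : L \subset S by apply/subsetP => x; rewrite inE => /andP[].
have [par parP] := leaf_parent e_sym cS S_gt2.
have cSL : #|S| = #|L| + #|S :\: L| by rewrite -(cardsID L S) (setIidPr sLS).
have kL : t.-1 * (k + 2) + 2 * k + 2 <= 2 * #|L| + t.
  apply: leq_trans (_ : 2 * (c + 2 * k) + t <= _); last first.
    rewrite leq_add2r leq_mul2l /=; apply: leq_trans many.
    by rewrite leq_pmull // muln_gt0 t_gt0.
  by move: k_gt0 t_gt0; rewrite /c !mulnDr; clear; lia.
have [||f fE] := nobook_emb r_sym e_sym e_irr k_gt0 nbW
  (conn_remove_leaves e_sym cS (subxx L)) (sparseS (subsetDl S L) spS).
- by move: cSL kL leT cW cWT; clear; lia.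
- by move: bigT cW cWT; clear; lia.
have [fW fI fe] := fE.
have parD x : x \in L -> par x \in S :\: L.
  by move=> xL; have [_ pS pL] := parP x xL; rewrite inE pS pL.
pose U := ~: f @: (S :\: L).
pose N x := [set u in U | r (f (par x)) u].
have cU : #|T| <= #|U| + #|S :\: L|.
  by rewrite -(cardsC (f @: (S :\: L))) addnC leq_add2l leq_imset_card.
have /card_gt0P[x0 x0L] : 0 < #|L| by move: kL k_gt0; clear; lia.
case: (boolP [exists J : {set V},
    (J \subset L) && (#|\bigcup_(j in J) N j| < #|J|)]); last first.
  move=> /existsPn nJ.
  have [J sJ|h hN hI] := @hall_marriage _ _ (f x0) N L.
    by have := nJ J; rewrite sJ /= -leqNgt.
  exists (fun x => if x \in L then h x else f x).
  apply: embeds_attach => //; first exact: embedsS (subsetT W) fE.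
    by move=> x /hN; rewrite inE in_setD in_setT andbT => /andP[]; rewrite in_setC.
  move=> x y xL yS exy; have [nbx _ pL] := parP x xL.
  have : y \in nbh e S x by rewrite nbhE yS.
  rewrite nbx => /set1P->; split=> //.
  by have := hN x xL; rewrite inE r_sym => /andP[].
case/existsP=> J /andP[sJL ltJ].
pose U' := U :\: \bigcup_(j in J) N j.
have blueU' j u : j \in J -> u \in U' -> blue (f (par j)) u.
  move=> jJ /setDP[uU uN]; rewrite /blue; apply/andP; split.
    move: uU; rewrite in_setC; apply: contraNneq => <-.
    by apply/imset_f/parD/(subsetP sJL).
  apply: contra uN => ru; apply/bigcupP; exists j => //.
  by rewrite inE uU.
have cU' : #|T| + #|L| < #|U'| + #|S| + #|J|.
  have := card_setD_ge U (\bigcup_(j in J) N j); rewrite -/U'.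
  by move: cU cSL ltJ; clear; lia.
have /card_gt0P[j0 j0J] : 0 < #|J| by apply: leq_ltn_trans ltJ.
have j0L := subsetP sJL j0 j0J.
pose K := U' :&: W.
have bK : blue_le r k.-1 K.
  apply: (@blue_leS _ _ _ _ (bnb W (f (par j0)))).
    by apply/subsetP => u /setIP[uU' uW]; rewrite inE uW blueU'.
  by apply: nobook_blue_le => //; apply: fW; apply: parD.
have cK : #|U'| <= #|K| + t.-1 * (k + 2).
  rewrite -(cardsID W U') leq_add2l; apply: leq_trans cW.
  by apply/subset_leq_card/subsetP => u /setDP[_ uW]; rewrite inE.
have cE : t.-1 * (k + 2) = c + t.-1 by rewrite /c !mulnDr muln1 muln2 -addnn addnA.
have leU' : #|S| + t.-1 + (#|L| - #|J|) <= #|U'|.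
  have := subset_leq_card sJL.
  by move: cU' leT t_gt0; clear; lia.
have leK : #|S| + (#|L| - #|J|) <= #|K| + c.
  by move: leU' cK cE; clear; lia.
have [bigK|smallK] := leqP (#|S| + 2 * k) #|K|.
  apply: embS (subsetT K) _.
  apply: (near_clique_emb r_sym e_sym e_irr spS bK).
    by move: bigK k_gt0; clear; lia.
  by rewrite prednK //; move: n4 bigK; clear; lia.
pose Q := f @: (par @: J).
have QP u : u \in Q -> exists2 j, j \in J & u = f (par j).
  by case/imsetP=> _ /imsetP[j jJ ->] ->; exists j.
have [bigQ|smallQ] := leqP (t * k) #|Q|.
  apply: embS (subsetT U') _.
  apply: (near_complete_emb r_sym e_sym e_irr spS _ _ n3 (t := t)); last first.
    by move: leU'; clear; lia.
  apply: contra nbk => bm; apply: booksS (subsetT (U' :|: Q)) _.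
  apply: (bmatch_books (c := 0)) => //; last by rewrite muln0 addn0.
    rewrite -setI_eq0; apply/eqP/setP => u; rewrite in_setI in_set0.
    by apply/negP => /andP[uU' /QP[j jJ E]]; have := blueU' j u jJ uU'; rewrite E blueF.
  move=> u uU'; rewrite leqn0 cards_eq0; apply/eqP/setP => w; rewrite in_set0 inE.
  by apply/negP => /andP[/QP[j jJ ->]]; rewrite blue_sym // blueU'.
have cQ : #|Q| = #|par @: J|.
  apply: card_in_imset => x y /imsetP[i iJ ->] /imsetP[j jJ ->].
  by apply: fI; apply/parD/(subsetP sJL).
have [p pJ big_p] : exists2 p, p \in par @: J &
    c + 2 * k <= #|[set x in J | par x == p]|.
  case: (boolP [exists p in par @: J, c + 2 * k <= #|[set x in J | par x == p]|]).
    by case/existsP=> p /andP[]; exists p.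
  move=> /existsPn nop.
  have : #|J| <= #|\bigcup_(p in par @: J) [set x in J | par x == p]|.
    apply/subset_leq_card/subsetP => x xJ; apply/bigcupP.
    by exists (par x); rewrite ?imset_f // inE xJ eqxx.
  have : #|\bigcup_(p in par @: J) [set x in J | par x == p]|
      <= #|par @: J| * (c + 2 * k).-1.
    apply: card_bigcup_le => p pJ; have := nop p; rewrite pJ /= -ltnNge.
    by move: k_gt0; clear; lia.
  rewrite -cQ => le1 le2.
  have le3 : #|Q| * (c + 2 * k).-1 <= (t * k).-1 * (c + 2 * k).-1.
    by rewrite leq_mul2r; apply/orP; right; move: smallQ; clear; lia.
  have tk : t * k * (c + 2 * k) = (t * k).-1 * (c + 2 * k).-1 + (t * k).-1 + (c + 2 * k).
    have : 0 < t * k by rewrite muln_gt0 t_gt0.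
    have : 0 < c + 2 * k by move: k_gt0; clear; lia.
    case: (t * k) => // a; case: (c + 2 * k) => // b _ _ /=.
    by rewrite mulSn mulnS; clear; lia.
  by move: le1 le2 le3 tk many leK smallK; clear; lia.
have [i iJ pE] := imsetP pJ; have iL := subsetP sJL i iJ.
have [_ pS pL] := parP i iL.
have sub : [set x in J | par x == p] \subset L.
  by apply: subset_trans sJL; apply/subsetP => x; rewrite inE => /andP[].
apply: (star_emb r_sym e_sym e_irr k_gt0 nbk nbW cW spS (p := p)
  (L := [set x in J | par x == p]) _ _ _ _ big_p n4 (K := K)) => //.
- by rewrite pE.
- exact: subset_trans sub sLS.
- by apply/negP => /(subsetP sub); rewrite pE (negbTE pL).
- move=> x xp; have [-> _ _] := parP x (subsetP sub x xp).
  by move: xp; rewrite inE => /andP[_ /eqP->].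
- exact: subsetIr.
- by move: leK; clear; lia.
apply: leq_ltn_trans n6; rewrite leq_add2r leq_add2l leq_mul2r; apply/orP; right.
by move: ltT; clear; lia.
Qed.

End Main.

(** * The Ramsey number *)

Lemma isbook_copy (T : finType) (r : rel T) k (D : {set T}) : isbook r k D ->
  exists g : book k -> T, [/\ injective g, forall x, g x \in D
    & forall x y, adj x y -> blue r (g x) (g y) || blue r (g y) (g x)].
Proof.
case/isbookP=> a [b [P [ab cP PP ->]]].
have szP (i : 'I_k) : i < size (enum P) by rewrite -cardE cP.
have inP (i : 'I_k) : nth a (enum P) i \in P by rewrite -mem_enum mem_nth.
pose g (u : book k) : T := match u with
  | inl i => if i == ord0 then a else b
  | inr j => nth a (enum P) j
  end.
have ord2 (i : 'I_2) : i != ord0 -> i = ord_max.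
  by case: i => [[|[|m]]] // lt _; apply: val_inj.
have aP : a \notin P by apply/negP => /PP[]; rewrite blueF.
have bP : b \notin P by apply/negP => /PP[]; rewrite blueF.
have ab' : a != b by case/andP: ab.
have glP i j : g (inl i) <> g (inr j).
  rewrite /g => E; have := inP j; rewrite -E.
  by case: ifP; rewrite (negbTE aP, negbTE bP).
exists g; split.
- case=> [i|i] [j|j].
  + rewrite /g; case: (eqVneq i ord0) => [i0|/ord2 i1];
      case: (eqVneq j ord0) => [j0|/ord2 j1] E; rewrite ?i0 ?j0 ?i1 ?j1 //;
      by rewrite E eqxx in ab'.
  + by move/glP.
  + by move/esym/glP.
  + move/eqP; rewrite /g nth_uniq ?enum_uniq // => /eqP E.
    by congr inr; apply: val_inj.
- case=> [i|j] /=; last by rewrite !in_setU1 inP !orbT.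
  by case: ifP => _; rewrite !in_setU1 eqxx ?orbT.
case=> [i|i] [j|j] //.
- rewrite /g [adj _ _]/(i != j).
  case: (eqVneq i ord0) => [i0|/ord2 i1];
    case: (eqVneq j ord0) => [j0|/ord2 j1]; rewrite ?ab ?orbT //.
    by rewrite i0 j0 eqxx.
  by rewrite i1 j1 eqxx.
- move=> _; have [pa pb] := PP _ (inP j); rewrite /g.
  by case: ifP => _; rewrite ?pa ?pb.
- move=> _; have [pa pb] := PP _ (inP i); rewrite /g.
  by case: ifP => _; rewrite ?pa ?pb orbT.
by case/andP=> ij /negP[].
Qed.

Lemma books_copies (T : finType) (r : rel T) k t (H : {set T}) :
    symmetric r -> books r k t H ->
  exists g : 'I_t -> book k -> T, [/\ forall i x, g i x \in H,
    forall i j x y, g i x = g j y -> i = j /\ x = y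
    & forall i x y, adj x y -> blue r (g i x) (g i y)].
Proof.
move=> r_sym; elim: t H => [|t IHt] H /=.
  move=> _; have no0 : 'I_0 -> False by case.
  by exists (fun i => False_rect _ (no0 i)); split=> i; case: (no0 i).
case/existsP=> D /and3P[/isbook_copy[g0 [g0I g0D g0e]] sD /IHt[g [gH gI ge]]].
exists (fun i => if unlift ord0 i is Some j then g j else g0); split.
- move=> i x; case: unliftP => [j _|_]; last exact: (subsetP sD).
  by have /setDP[] := gH j x.
- move=> i j x y; case: unliftP => [i' ->|->]; case: unliftP => [j' ->|->].
  + by case/gI=> -> ->.
  + by move=> E; have /setDP[_] := gH i' x; rewrite E g0D.
  + by move=> E; have /setDP[_] := gH j' y; rewrite -E g0D.
  + by move/g0I->.
move=> i x y xy; case: unliftP => [j _|_]; first exact: ge.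
by have := g0e x y xy; rewrite blue_sym // orbb.
Qed.

Lemma degree_sum_edges (G : sgraph) :
  degree_sum (@adj G) [set: G] <= 2 * #|edges G|.
Proof.
pose A := [set p : G * G | adj p.1 p.2].
have -> : degree_sum (@adj G) [set: G] = #|A|.
  rewrite /degree_sum -sum1_card (eq_bigl (fun p : G * G => adj p.1 p.2)) => [|p].
    rewrite -(pair_big_dep xpredT (fun x y => adj x y) (fun _ _ => 1)) /=.
    apply: eq_big => [x|x _]; first by rewrite in_setT.
    by rewrite -sum1_card; apply: eq_bigl => y; rewrite !inE.
  by rewrite inE.
apply: (@leq_trans #|\bigcup_(E in edges G) [set p in A | [set p.1; p.2] == E]|).
  apply/subset_leq_card/subsetP => p pA; apply/bigcupP; exists [set p.1; p.2].
    by apply/imsetP; exists p => //; rewrite inE in pA *.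
  by rewrite inE pA eqxx.
rewrite mulnC; apply: card_bigcup_le => _ /imsetP[[a b] _ ->] /=.
apply: (@leq_trans #|[set (a, b); (b, a)]|); last by rewrite cards2; case: (_ != _).
apply/subset_leq_card/subsetP => -[u v]; rewrite !inE /= => /andP[uv /eqP E].
have uNv : u != v by apply: contraTneq uv => ->; rewrite adj_irrefl.
have uab := set21 u v; have vab := set22 u v; rewrite E in uab vab.
case/set2P: uab uNv => ->; case/set2P: vab => ->; by rewrite ?eqxx ?orbT.
Qed.

Lemma connected_conn (G : sgraph) : connected_graph G -> conn (@adj G) [set: G].
Proof.
case=> _ cG X _ /set0Pn[x xX] clX; apply/setP => y; rewrite in_setT.
have /connectP[p] := cG x y; elim: p x xX => [|z p IHp] x xX /=; first by move=> _ ->.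
by case/andP=> xz; apply: IHp; apply: (clX x).
Qed.

Lemma connected_sparse (G : sgraph) l : connected_graph G ->
  #|edges G| <= #|G| + l -> sparse (@adj G) l [set: G].
Proof.
move=> /connected_conn cG leE X _.
have [->|X0] := eqVneq X set0; first by rewrite /degree_sum big_set0.
have [n] := ubnP #|~: X|; elim: n X X0 => // n IHn X X0 ltX.
have [->|XT] := eqVneq X [set: G].
  by apply: leq_trans (degree_sum_edges G) _; rewrite cardsT leq_mul2l leE.
have [x xX [y yX xy]] : exists2 x, x \in X & exists2 y, y \notin X & adj x y.
  case: (boolP [exists x in X, exists y, (y \notin X) && adj x y]).
    by case/existsP=> x /andP[xX /existsP[y /andP[yX xy]]]; exists x => //; exists y.
  move/existsPn=> no; case/eqP: XT; apply: cG => [||x y xX _ xy].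
  - exact: subsetT.
  - by [].
  apply/negPn/negP => yX; case/negP: (no x); rewrite xX /=.
  by apply/existsP; exists y; rewrite yX.
have nb : 0 < #|nbh (@adj G) X y|.
  by apply/card_gt0P; exists x; rewrite nbhE xX adj_sym.
have yX0 : y |: X != set0 by apply/set0Pn; exists y; rewrite setU11.
have lty : #|~: (y |: X)| < n.
  have := cardsC X; have := cardsC (y |: X); rewrite cardsU1 yX.
  by move: ltX; clear; lia.
have := IHn _ yX0 lty.
rewrite (degree_sumU1 (@adj_sym G) (@adj_irrefl G)) // cardsU1 yX.
by move: nb; clear; lia.
Qed.

Lemma color_pair N (cl : 'I_N -> nat) (x y : 'I_N) : x != y ->
  [exists u in [set x; y], [exists v in [set x; y], (u != v) && (cl u == cl v)]]
    = (cl x == cl y).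
Proof.
move=> xy; apply/existsP/idP => [[u /andP[/set2P uxy /existsP[v]]]|E].
  case/andP=> /set2P vxy /andP[uv /eqP E].
  by move: uxy vxy uv E => [->|->] [->|->]; rewrite ?eqxx // => _ ->.
exists x; rewrite set21; apply/existsP; exists y.
by rewrite set22 xy.
Qed.

Lemma lower_bound (G : sgraph) k t M : 0 < k -> 0 < t -> connected_graph G ->
    t <= #|G| -> M < 2 * #|G| + t - 2 ->
  ~ arrows M G (copies t (book k)).
Proof.
move=> k_gt0 t_gt0 [G_gt0 cG] leG ltM.
pose n1 := #|G|.-1.
pose cl (x : 'I_M) : nat := if x < n1 then 0 else if x < 2 * n1 then 1 else 2.
pose c : coloring M := fun A =>
  [exists u in A, [exists v in A, (u != v) && (cl u == cl v)]].
have cE x y : x != y -> c [set x; y] = (cl x == cl y) by exact: color_pair.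
have class_card (d m : nat) (A : {set 'I_M}) :
    (forall x : 'I_M, x \in A -> d <= x < d + m) -> #|A| <= m.
  move=> dA; have -> : m = size (iota d m) by rewrite size_iota.
  have -> : #|A| = size [seq val x | x <- enum A] by rewrite size_map -cardE.
  apply: uniq_leq_size; first by rewrite map_inj_uniq ?enum_uniq //; apply: val_inj.
  by move=> _ /mapP[x xA ->]; rewrite mem_iota; apply: dA; rewrite -mem_enum.
move=> /(_ c) [[f fI fe]|[f fI fe]].
  have cl_adj x y : adj x y -> cl (f x) = cl (f y).
    by move/fe=> /andP[xy]; rewrite cE // => /eqP/eqP.
  have /card_gt0P[x0 _] := G_gt0.
  have clf y : cl (f y) = cl (f x0).
    have /connectP[p] := cG x0 y; elim: p x0 => [|z p IHp] x /=; first by move=> _ ->.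
    by case/andP=> /cl_adj->; apply: IHp.
  have cf : #|[set f y | y : G]| = #|G| by rewrite card_imset.
  have : #|[set f y | y : G]| <= n1.
    have inf x : x \in [set f y | y : G] -> cl x = cl (f x0).
      by case/imsetP=> y _ ->.
    move: (cl (f x0)) inf => v inf.
    have [v0|v0] := eqVneq v 0.
      apply: (class_card 0) => x /inf; rewrite v0 /cl; case: ifP => //.
      by case: ifP.
    have [v1|v1] := eqVneq v 1.
      apply: (class_card n1) => x /inf; rewrite v1 /cl; case: ltnP => // h1.
      by case: ltnP => // h2 _; rewrite addnn -mul2n.
    apply: (class_card (2 * n1)) => x /inf; rewrite /cl.
    case: ifP => [_ E|_]; first by rewrite -E eqxx in v0.
    case: ltnP => [_ E|h2 _]; first by rewrite -E eqxx in v1.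
    apply: leq_trans (ltn_ord x) _.
    by move: ltM leG G_gt0; rewrite /n1; clear; lia.
  by rewrite cf /n1; move: G_gt0; clear; lia.
have blue_cl u v : @adj (copies t (book k)) u v -> cl (f u) != cl (f v).
  move/fe=> /andP[xy]; rewrite cE // => /eqP E.
  by rewrite E.
pose a i : copies t (book k) := (i, inl ord0).
pose b i : copies t (book k) := (i, inl ord_max).
pose d i : copies t (book k) := (i, inr (Ordinal k_gt0)).
have two x : cl x = 0 \/ cl x = 1 \/ cl x = 2.
  by rewrite /cl; case: ifP; [left|case: ifP; right; [left|right]].
have pick2 i : exists u : copies t (book k), (u.1 == i) && (cl (f u) == 2).
  have ab : cl (f (a i)) != cl (f (b i)).
    by apply: blue_cl; rewrite /adj /= /copies_adj /= eqxx.
  have ad : cl (f (a i)) != cl (f (d i)).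
    by apply: blue_cl; rewrite /adj /= /copies_adj /= eqxx.
  have bd : cl (f (b i)) != cl (f (d i)).
    by apply: blue_cl; rewrite /adj /= /copies_adj /= eqxx.
  have [E|NE] := eqVneq (cl (f (a i))) 2; first by exists (a i); rewrite eqxx E.
  have [E|NE'] := eqVneq (cl (f (b i))) 2; first by exists (b i); rewrite eqxx E.
  exists (d i); rewrite eqxx /=.
  by move: ab ad bd NE NE'; case: (two (f (a i))) => [->|[->|->]] //;
    case: (two (f (b i))) => [->|[->|->]] //; case: (two (f (d i))) => [->|[->|->]].
pose u i := xchoose (pick2 i).
have uP i : (u i).1 = i /\ cl (f (u i)) = 2.
  by have /andP[/eqP ? /eqP ?] := xchooseP (pick2 i).
have uI : injective (fun i => f (u i)).
  by move=> i j /fI E; have [<- _] := uP i; have [<- _] := uP j; rewrite E.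
have : #|[set f (u i) | i : 'I_t]| <= M - 2 * n1.
  apply: (class_card (2 * n1)) => _ /imsetP[i _ ->].
  have [_] := uP i; rewrite /cl; case: ifP => // _; case: ltnP => // h _.
  by rewrite subnKC ?ltn_ord // (leq_trans h) // ltnW ?ltn_ord.
rewrite card_imset // card_ord.
by move: ltM t_gt0 G_gt0; rewrite /n1; clear; lia.
Qed.

Section Numerics.
Variables (k t l n : nat).
Hypotheses (k_gt0 : 0 < k) (t_gt0 : 0 < t).
Hypotheses (n_ge : 111 * (t ^ 3 * k ^ 3) <= n)
  (l_le : l * (127 * (t ^ 2 * k ^ 2) + 79 * (t ^ 2 * k)) <= n).

Let c := t.-1 * (k + 1).

Lemma numeric_facts :
  [/\ 206 * (t * k * l) <= n, 111 * (t * k * (t * k * (t * k))) <= n,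
      [/\ 0 < t * k, k <= t * k & t <= t * k], l <= t * k * l /\ k * l <= t * k * l
    & [/\ t + k <= t * k + 1, c + k + 1 = t * k + t
      & t.-1 * (k + 2) + 1 = c + t]].
Proof.
have tk : t + k <= t * k + 1.
  move: k_gt0 t_gt0; case: (k) => // a; case: (t) => // b _ _.
  by rewrite mulSn mulnS; clear; lia.
split.
- apply: leq_trans l_le.
  have a1 : t * k <= t ^ 2 * k ^ 2.
    by rewrite -expnMn -mulnn leq_pmulr // muln_gt0 t_gt0.
  have a2 : t * k <= t ^ 2 * k by rewrite leq_mul2r -mulnn leq_pmulr ?orbT.
  apply: (@leq_trans (l * (127 * (t * k) + 79 * (t * k)))); first by clear; lia.
  by rewrite leq_mul2l; apply/orP; right; move: a1 a2; clear; lia.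
- by apply: leq_trans n_ge; rewrite -expnMn expnS -mulnn.
- by rewrite muln_gt0 t_gt0 k_gt0 leq_pmull ?leq_pmulr.
- by split; [rewrite leq_pmull // muln_gt0 t_gt0 | rewrite leq_mul2r leq_pmull ?orbT].
split=> //; rewrite /c; move: t_gt0; case: (t) => // b _ /=.
  by rewrite mulnDr mulSn; clear; lia.
by rewrite !mulnDr; clear; lia.
Qed.

Lemma host_numeric :
  60 * (k * l) + 60 * l + 13 * k + 15 + t.-1 * (k + 2) <= 2 * n + t - 2.
Proof.
have [h1 h2 [h3 h3' h4] [h5 h6] [h7 h8 h9]] := numeric_facts.
have h10 : t * k <= t * k * (t * k * (t * k)) by rewrite leq_pmulr // muln_gt0 h3.
move: (t * k * (t * k * (t * k))) (t * k * l) (t * k) (k * l) (t.-1 * (k + 2))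
  h1 h2 h3 h3' h4 h5 h6 h7 h8 h9 h10 => C3 X Y kl d.
by move: t_gt0 k_gt0; clear; lia.
Qed.

Lemma guest_numeric m : 2 * n + t - 2 < 2 * m + 2 * k + t.-1 * (k + 2) ->
  large k t l m.
Proof.
have [h1 h2 [h3 h3' h4] [h5 h6] [h7 h8 h9]] := numeric_facts.
have h10 : t * k <= t * k * (t * k).
  by rewrite leq_pmulr.
have h11 : t * k * (t * k) <= t * k * (t * k * (t * k)).
  by rewrite leq_mul2l h10 orbT.
move=> ltm; have nm : n <= m + t * k.
  by move: ltm t_gt0 h7 h8 h9; clear; lia.
have c2 : c + 2 * k <= 2 * (t * k) by move: h7 h8; clear; lia.
split.
- move=> s lts.
  have s_le : s.+1 <= 2 * (t * k * (t * k)).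
    apply: leq_trans lts _; rewrite mulnCA leq_mul2l; apply/orP; right.
    exact: c2.
  have q_le : (3 * (t * k) + 4 * t).-1 <= 7 * (t * k) by move: h4; clear; lia.
  have p_le : (3 * (t * k) + 4 * t).-1 * (6 * l + 4 * s)
      <= 42 * (t * k * l) + 28 * (t * k * s).
    apply: (@leq_trans (7 * (t * k) * (6 * l + 4 * s))).
      by rewrite leq_mul2r q_le orbT.
    by clear; nia.
  have ts : t * k * s + t * k <= 2 * (t * k * (t * k * (t * k))).
    by rewrite -mulnSr mulnCA leq_mul2l s_le orbT.
  by move: h1 h2 h3 h5 h10 h11 nm s_le p_le ts; clear; lia.
- by move: h2 h3 h4 h10 h11 nm; clear; lia.
- by move: h1 h2 h3 h4 h5 h10 h11 nm; clear; lia.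
split.
- rewrite mulnDr mulnCA; move: h1 h2 h3 h6 h10 h11 nm c2; rewrite /c; clear; lia.
- by move: h2 h3 h10 h11 nm c2 h3'; rewrite /c; clear; lia.
have f1 : 3 * k + 2 * c + t.-1 * (k + 2) <= 7 * (t * k).
  by move: h3 h4 h9 c2; clear; lia.
have f2 : c + 2 * k + t * (k + 2) <= 5 * (t * k).
  by rewrite mulnDr; move: h4 c2; clear; lia.
have := leq_mul f1 f2; rewrite /c mulnACA.
by move: h2 h3 h10 h11 nm c2; rewrite /c; clear; lia.
Qed.

End Numerics.

Lemma edge_excess (k t n m : nat) : 0 < k -> 0 < t ->
    (m%:R <= n%:R * (1 + 1 / (127 * t%:R ^+ 2 * k%:R ^+ 2 + 79 * t%:R ^+ 2 * k%:R))
      :> rat)%R ->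
  (m - n) * (127 * (t ^ 2 * k ^ 2) + 79 * (t ^ 2 * k)) <= n.
Proof.
move=> k_gt0 t_gt0; set D := 127 * (t ^ 2 * k ^ 2) + 79 * (t ^ 2 * k).
have D_gt0 : 0 < D by rewrite addn_gt0 !muln_gt0 t_gt0 k_gt0.
have -> : (127 * t%:R ^+ 2 * k%:R ^+ 2 + 79 * t%:R ^+ 2 * k%:R = D%:R :> rat)%R.
  by rewrite -!natrX -!natrM -natrD /D !mulnA.
have D0 : (0 < D%:R :> rat)%R by rewrite ltr0n.
rewrite mulrDr mulr1 mul1r -(ler_pM2r D0) mulrDl mulrVK; last by rewrite unitfE gt_eqF.
rewrite -!natrM -natrD ler_nat mulnBl => le.
by rewrite leq_subLR.
Qed.

Lemma arrows_copies_book (k t l n : nat) (G : sgraph) : 0 < k -> 0 < t ->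
    connected_graph G -> #|G| = n -> #|edges G| <= n + l ->
    111 * (t ^ 3 * k ^ 3) <= n ->
    l * (127 * (t ^ 2 * k ^ 2) + 79 * (t ^ 2 * k)) <= n ->
  arrows (2 * n + t - 2) G (copies t (book k)).
Proof.
move=> k_gt0 t_gt0 cG nG leE n_ge l_le c.
set N := 2 * n + t - 2.
pose r : rel 'I_N := @adj (color_class c true).
have r_sym : symmetric r := @adj_sym (color_class c true).
have blueE x y : blue r x y -> @adj (color_class c false) x y.
  case/andP=> xy; rewrite /r /= /color_adj /= /complete_adj xy /=.
  by case: (c _).
have [bk|nbk] := boolP (books r k t setT).
  right; have [g [_ gI ge]] := books_copies r_sym bk.
  exists (fun u : copies t (book k) => g u.1 u.2).
    by move=> [i x] [j y] /gI[/= -> ->].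
  by move=> [i x] [j y] /andP[/eqP/= <- xy]; apply/blueE/ge.
left; have n_gt0 : 0 < n by rewrite -nG; case: cG.
have [||||f [_ fI fe]] := sparse_conn_emb r_sym k_gt0 nbk (@adj_sym G) (@adj_irrefl G)
  (connected_conn cG) (@connected_sparse G l cG _).
- by rewrite nG.
- by rewrite cardsT nG card_ord /N; move: n_gt0; clear; lia.
- by move=> m; rewrite card_ord; apply: guest_numeric n_ge l_le _.
- by rewrite card_ord; apply: host_numeric n_ge l_le.
by exists f => [x y|x y]; [apply: fI|apply: fe]; rewrite in_setT.
Qed.

Theorem theorem1p10 (k t n : nat) (G : sgraph)
    (hk : 0 < k) (ht : 0 < t)
    (hn : 111 * t ^ 3 * k ^ 3 <= n)
    (hconn : connected_graph G)
    (hvert : #|G| = n)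
    (hedge : (#|edges G|%:R <=
      n%:R * (1 + 1 / (127 * t%:R ^+ 2 * k%:R ^+ 2 + 79 * t%:R ^+ 2 * k%:R))
        :> rat)%R) :
  is_ramsey_number G (copies t (book k)) (2 * n + t - 2).
Proof.
rewrite -mulnA in hn; have n_gt0 : 0 < n by rewrite -hvert; case: hconn.
split; first by move: n_gt0 ht; clear; lia.
  apply: (arrows_copies_book (l := #|edges G| - n)) => //; last exact: edge_excess.
  by rewrite -leq_subLR.
move=> M _ arM; rewrite leqNgt; apply/negP => ltM.
apply: (lower_bound hk ht hconn _ _ arM); rewrite hvert //.
have [_ h2 [h3 _ h4] _ _] := numeric_facts (l := 0) hk ht hn (leq0n n).
apply: leq_trans h4 _; apply: leq_trans h2; rewrite mulnCA leq_pmulr //.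
by rewrite !muln_gt0 hk ht.
Qed.
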